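(* Let $L$ and $N$ be integers with $L\ge1$ and $0\le N<L/2$, and let $p\in[0,1]$. Let $(\eta_t)_{t\ge0}$ be the facilitated asymmetric exclusion process (F-ASEP) with asymmetry parameter $p$ and $N$ particles on the ring $\mathbb{Z}_L$, started from the uniform distribution on $X^{(N)}=\{\eta\in\{0,1\}^{\mathbb{Z}_L}: \sum_i\eta(i)=N\}$, let $\eta_\infty=\lim_{t\to\infty}\eta_t$ (which exists almost surely), and let $\mu^{(N)}_\infty$ be the distribution of $\eta_\infty$. Then $\mu^{(N)}_\infty$ is independent of $p$, and is given for every $p$ by $$\mu^{(N)}_\infty=\frac1L\sum_{i=0}^{L-1}(\tau^i)_*\nu^{(N)},$$ where $\nu^{(N)}$ is the probability measure on $X^{(N)}$ defined in the context.
   Context: $\mathbb{Z}_L=\{0,1,\dots,L-1\}$ with periodic boundary conditions (site arithmetic mod $L$). The F-ASEP with parameter $p$ on $\mathbb{Z}_L$ is the continuous-time Markov chain on $\{0,1\}^{\mathbb{Z}_L}$ in which a particle at $i$ jumps to $i+1$ at rate $p$ if $\eta(i-1)=\eta(i)=1$ and $\eta(i+1)=0$, and a particle at $i$ jumps to $i-1$ at rate $1-p$ if $\eta(i+1)=\eta(i)=1$ and $\eta(i-1)=0$. The number of particles is conserved. $\tau$ is translation, $(\tau\eta)(i)=\eta(i-1)$, and $f_*\lambda$ denotes push-forward of the measure $\lambda$ by $f$. Let $c_n=\frac1{n+1}\binom{2n}{n}$ be the Catalan numbers. Call $(q_0,\dots,q_{L-2N-1})$ admissible if $0=q_0<q_1<\dots<q_{L-2N-1}\le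 L-1$ and, with $q_{L-2N}:=L$, each gap is odd: $q_{i+1}-q_i=2n_i+1$ with $n_i\ge0$ an integer, $0\le i\le L-2N-1$. For an admissible tuple let $\eta^{(q_0,\dots,q_{L-2N-1})}\in X^{(N)}$ be the configuration whose values on the sites $1,2,\dots,L$ (site $L$ being identified with site $0$) form the string $$(10)^{n_0}\,0\,(10)^{n_1}\,0\cdots(10)^{n_{L-2N-1}}\,0.$$ $\nu^{(N)}$ is the probability measure on $X^{(N)}$ concentrated on these configurations with $$\nu^{(N)}\bigl(\{\eta^{(q_0,\dots,q_{L-2N-1})}\}\bigr)=\frac{L\prod_{i=0}^{L-2N-1}c_{n_i}}{(L-2N)\binom{L}{N}}.$$ *)

(* Defs.v *)
From HB Require Import structures.
From mathcomp Require Import all_boot all_order all_algebra.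
From mathcomp Require Import all_classical all_reals all_analysis.

Set Implicit Arguments.
Unset Strict Implicit.
Unset Printing Implicit Defensive.

Import Order.TTheory GRing.Theory Num.Theory.
Import numFieldNormedType.Exports.

Local Open Scope classical_set_scope.
Local Open Scope ring_scope.

(* The ring Z_L is 'I_L: ordS and ord_pred are i |-> i + 1 and i |-> i - 1
   modulo L. *)
Definition config (L : nat) : Type := {ffun 'I_L -> bool}.

HB.instance Definition _ L := Finite.copy (config L) {ffun 'I_L -> bool}.
HB.instance Definition _ L :=
  isPointed.Build (config L) ([ffun=> false] : {ffun 'I_L -> bool}).
HB.instance Definition _ L := hasNbhs.Build (config L) principal_filter.
HB.instance Definition _ L := Discrete_ofNbhs.Build (config L) erefl.
HB.instance Definition _ L := @isMeasurable.Build default_measure_display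
  (config L) discrete_measurable discrete_measurable0
  discrete_measurableC discrete_measurableU.

Section configurations.
Variable L : nat.

Definition mk_config (f : 'I_L -> bool) : config L := finfun f.

Definition occ (eta : config L) (i : 'I_L) : bool :=
  (eta : {ffun 'I_L -> bool}) i.

Definition n_particles (eta : config L) : nat := (\sum_(i < L) occ eta i)%N.

Definition sector (N : nat) : {set config L} :=
  [set eta | n_particles eta == N].

Definition tau (eta : config L) : config L :=
  mk_config (fun i => occ eta (ord_pred i)).

Definition hop (eta : config L) (i j : 'I_L) : config L :=
  mk_config (fun k => if k == i then false
                      else if k == j then true else occ eta k).

End configurations.

Section markov_chain.
Variables (R : realType) (L : nat).

Definition fasep_rate (p : R) (eta zeta : config L) : R :=
  \sum_(i < L)
    (p *+ [&& occ eta (ord_pred i), occ eta i, ~~ occ eta (ordS i)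
            & zeta == hop eta i (ordS i)]
     + (1 - p) *+ [&& occ eta (ordS i), occ eta i, ~~ occ eta (ord_pred i)
            & zeta == hop eta i (ord_pred i)]).

Definition generator (q : config L -> config L -> R) (f : config L -> R) :
    config L -> R :=
  fun x => \sum_(y : config L) q x y * (f y - f x).

(* The (x, y) entry of exp(t G), where G is the generator with rates q. *)
Definition transition (q : config L -> config L -> R) (t : R)
    (x y : config L) : R :=
  limn (series (fun k : nat =>
    t ^+ k / k`!%:R * iter k (generator q) (fun z => (z == y)%:R) x)).

Fixpoint path_weight (q : config L -> config L -> R) (s : R) (x : config L)
    (l : seq (R * config L)) : R :=
  if l is (t, y) :: l' then transition q (t - s) x y * path_weight q t y l'
  else 1.

(* X is a continuous-time Markov chain with jump rates q and initial law init:
   its paths are right-continuous and, for all 0 <= t_1 <= ... <= t_n,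
   P(X_0 = x_0, X_{t_1} = x_1, ..., X_{t_n} = x_n)
     = init(x_0) prod_k exp((t_k - t_{k-1}) G)(x_{k-1}, x_k), with t_0 = 0.
   Only the values of X at times t >= 0 matter. *)
Record is_markov_chain d (Omega : measurableType d) (P : probability Omega R)
    (q : config L -> config L -> R) (init : config L -> R)
    (X : R -> {RV P >-> config L}) : Prop := {
  right_continuous_paths : forall (w : Omega) (t : R), 0 <= t ->
    X s w @[s --> t^'+] --> X t w ;
  finite_dim_laws : forall (x : config L) (l : seq (R * config L)),
    path <=%R 0 (unzip1 l) ->
    P [set w | X 0 w = x /\ forall a, a \in l -> X a.1 w = a.2]
      = (init x * path_weight q 0 x l)%:E }.

Definition uniform_law (N : nat) (eta : config L) : R :=
  (eta \in sector L N)%:R / #|sector L N|%:R.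

Definition is_fasep d (Omega : measurableType d) (P : probability Omega R)
    (p : R) (N : nat) (eta : R -> {RV P >-> config L}) : Prop :=
  is_markov_chain (fasep_rate p) (uniform_law N) eta.

(* Almost surely the limit exists; where it does not, lim returns an arbitrary
   fixed configuration. *)
Definition eta_infty d (Omega : measurableType d) (P : probability Omega R)
    (eta : R -> {RV P >-> config L}) (w : Omega) : config L :=
  lim (eta t w @[t --> +oo]).

End markov_chain.

Section nu.
Variables (R : realType) (L N : nat).

Definition catalan (n : nat) : R := n.+1%:R^-1 * 'C(2 * n, n)%:R.

(* q_i, with the convention q_(L - 2N) = L supplied by the default value. *)
Definition qv (q : (L - 2 * N).-tuple 'I_L) (i : nat) : nat :=
  nth L (map val q) i.

Definition admissible (q : (L - 2 * N).-tuple 'I_L) : bool :=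
  [&& qv q 0 == 0, sorted ltn (map val q)
    & [forall i : 'I_(L - 2 * N), odd (qv q i.+1 - qv q i)]]%N.

Definition gap_index (q : (L - 2 * N).-tuple 'I_L) (i : nat) : nat :=
  ((qv q i.+1 - qv q i)./2)%N.

Definition block (n : nat) : seq bool :=
  rcons (flatten (nseq n [:: true; false])) false.

Definition word (q : (L - 2 * N).-tuple 'I_L) : seq bool :=
  flatten [seq block (gap_index q i) | i <- iota 0 (L - 2 * N)].

(* The letters of the word occupy sites 1, ..., L, site L being site 0. *)
Definition config_of (q : (L - 2 * N).-tuple 'I_L) : config L :=
  mk_config (fun i => nth false (word q) (ord_pred i)).

Definition nu_weight (q : (L - 2 * N).-tuple 'I_L) : R :=
  L%:R * (\prod_(i < L - 2 * N) catalan (gap_index q i))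
  / ((L - 2 * N)%:R * 'C(L, N)%:R).

Definition nu (A : set (config L)) : \bar R :=
  (\sum_(q : (L - 2 * N).-tuple 'I_L | admissible q)
    (nu_weight q)%:E * \d_(config_of q) A)%E.

Lemma config_of_inj : {in admissible &, injective config_of}.
Proof.
move=> q q' /and3P[/eqP q0 qs /forallP qo] /and3P[/eqP q0' qs' /forallP qo'] Eq.
have blockE n : block n.+1 = [:: true, false & block n] by [].
have block_inj n n' s s' : block n ++ s = block n' ++ s' -> n = n' /\ s = s'.
  elim: n n' => [|n IHn] [|n'] /=; rewrite ?blockE //=; first by case.
  by case=> /IHn[-> ->].
have flatten_inj (f g : nat -> nat) r :
    flatten [seq block (f i) | i <- r] = flatten [seq block (g i) | i <- r] ->
    {in r, f =1 g}.
  elim: r => [|a r IHr] //= /block_inj[fga /IHr fg] i.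
  by rewrite inE => /orP[/eqP ->|/fg].
have size_block n : size (block n) = n.*2.+1.
  by elim: n => [|n IHn] //; rewrite blockE /= IHn.
have qvL (r : (L - 2 * N).-tuple 'I_L) : qv r (L - 2 * N)%N = L.
  by rewrite /qv nth_default // size_map size_tuple.
have qvS (r : (L - 2 * N).-tuple 'I_L) i : sorted ltn (map val r) ->
    (i < L - 2 * N)%N -> odd (qv r i.+1 - qv r i) ->
    qv r i.+1 = (qv r i + (gap_index r i).*2.+1)%N.
  move=> rs iL ro; have lt : (qv r i < qv r i.+1)%N.
    by case: (qv r i.+1 - qv r i)%N ro (subn_gt0 (qv r i) (qv r i.+1)).
  rewrite /gap_index; have := odd_double_half (qv r i.+1 - qv r i).
  by rewrite ro add1n => ->; rewrite subnKC // ltnW.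
have size_word (r : (L - 2 * N).-tuple 'I_L) : admissible r ->
    size (word r) = L.
  case/and3P=> /eqP r0 rs /forallP ro; rewrite -[RHS](qvL r) /word.
  suff H k : (k <= L - 2 * N)%N ->
      size (flatten [seq block (gap_index r i) | i <- iota 0 k]) = qv r k.
    exact: H.
  elim: k => [|k IHk] kL; first by rewrite r0.
  rewrite -addn1 iotaD map_cat flatten_cat size_cat IHk 1?ltnW //= cats0 add0n.
  by rewrite size_block addn1 [RHS]qvS //; exact: (ro (Ordinal kL)).
have Ew : word q = word q'.
  apply: (@eq_from_nth _ false) => [|k].
    by rewrite !size_word //; apply/and3P; split=> //; exact/eqP || exact/forallP.
  rewrite size_word => [kL|]; last by apply/and3P; split; [exact/eqP| |exact/forallP].
  have /(congr1 (fun eta => occ eta (ordS (Ordinal kL)))) := Eq.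
  by rewrite /occ /config_of /mk_config !ffunE ordSK.
have gE i : (i < L - 2 * N)%N -> gap_index q i = gap_index q' i.
  by move=> iL; apply: (flatten_inj _ _ _ Ew); rewrite mem_iota.
have qvE i : (i <= L - 2 * N)%N -> qv q i = qv q' i.
  elim: i => [|i IHi] iL; first by rewrite q0.
  rewrite (qvS q i qs iL (qo (Ordinal iL))) (qvS q' i qs' iL (qo' (Ordinal iL))).
  by rewrite IHi 1?ltnW // gE.
apply/val_inj/(inj_map val_inj)/(@eq_from_nth _ L) => [|i].
  by rewrite !size_map !size_tuple.
by rewrite size_map size_tuple => /ltnW/qvE.
Qed.

Lemma nu_config_of (q : (L - 2 * N).-tuple 'I_L) :
  admissible q -> nu [set config_of q] = (nu_weight q)%:E.
Proof.
move=> qa; rewrite /nu (bigD1 q) //= big1 => [|r /andP[ra rq]].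
  by rewrite adde0 diracE mem_set // mule1.
rewrite diracE memNset ?mule0 //= => /(config_of_inj ra qa) /eqP.
exact/negP.
Qed.

End nu.

(* Main.v *)
From HB Require Import structures.
Require Import Defs.
From mathcomp Require Import all_boot all_order all_algebra.
From mathcomp Require Import all_classical all_reals all_analysis.
From mathcomp Require Import zify ring lra.

Set Implicit Arguments.
Unset Strict Implicit.
Unset Printing Implicit Defensive.

Import Order.TTheory GRing.Theory Num.Theory.
Import numFieldNormedType.Exports.

Local Open Scope classical_set_scope.
Local Open Scope ring_scope.

(* For a frozen configuration z let h_z be the harmonic function with boundary
   value the indicator of z, i.e. the probability of absorption at z.  No hop
   creates a pair of adjacent holes, so h_z(x) = 0 unless x has all the adjacent
   holes of z; these pairs then cut the ring into blocks 0(10)^n which do not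
   interact before absorption, and h_z is a product over the blocks, the factor of
   a block being the same function on the ring with 2n+1 sites.  On that ring with
   n particles the only frozen configurations are the 2n+1 rotations of 0(10)^n.
   By rotation invariance the sums of their functions h over all initial
   configurations are equal, and they add up to 'C(2n+1, n), so each of them is
   'C(2n+1, n) / (2n+1), the n-th Catalan number, whatever p is.  Hence the limit
   is z with probability the product of the Catalan numbers of the blocks divided
   by 'C(L, N). *)

(** * Dynamics *)

(** The functions h_z are built analytically, as solutions of a Dirichlet problem: uniqueness is a
    maximum principle, and existence follows from it in finite dimension. The obstacle is p = 0 or p
    = 1, where particles hop one way only: a frozen configuration must be reachable by hops in a
    single direction, which a decreasing potential ensures. Passage to the process: the expectation
    of h_z(eta_t) is constant in t, and the probability of not being frozen at time t is O(1/t). So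
    P(eta_t = z) is at least the claimed limit minus O(1/t). Lower bounds suffice because the
    claimed limits add up to 1, and the same count shows that almost every path converges.
    Comparison with nu: a frozen z with N particles has exactly L - 2N pairs of adjacent holes, and
    nu is the limit law conditioned on such a pair at the sites L - 1 and 0. Running through all
    rotations counts z once for each of its pairs, which compensates the normalisation L / (L -
    2N). *)

Section dynamics.
Variable L : nat.
Implicit Types (x y : config L) (h i j k : 'I_L).

Lemma occ_mk (f : 'I_L -> bool) i : occ (mk_config f) i = f i.
Proof. by rewrite /occ /mk_config ffunE. Qed.

Lemma config_eqP x y : (forall i, occ x i = occ y i) -> x = y.
Proof. by move=> xy; apply/ffunP => i; exact: xy. Qed.

Lemma occ_hop x i j k :
  occ (hop x i j) k = if k == i then false else if k == j then true else occ x k.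
Proof. by rewrite occ_mk. Qed.

Definition facil x h i j := [&& occ x h, occ x i & ~~ occ x j].

Definition pair2 x i := occ x (ord_pred i) && occ x i.
Definition vacant2 x i := ~~ occ x (ord_pred i) && ~~ occ x i.
Definition frozen x := [forall i, ~~ pair2 x i].

Lemma frozenP x i : frozen x -> occ x i -> occ x (ordS i) = false.
Proof.
move=> /forallP/(_ (ordS i)); rewrite /pair2 ordSK => + xi.
by rewrite xi => /negbTE.
Qed.

Lemma n_particles_hop x h i j : facil x h i j ->
  n_particles (hop x i j) = n_particles x.
Proof.
case/and3P=> _ xi xj; have ij : j != i by apply: contraNneq xj => ->.
rewrite /n_particles [LHS](bigD1 i) //= [RHS](bigD1 i) //= (bigD1 j) //=.
rewrite [X in (_ = _ + X)%N](bigD1 j) //= !occ_hop eqxx (negbTE ij) eqxx xi.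
rewrite (negbTE xj) /= add0n; congr addn; apply: eq_bigr => k /andP[ki kj].
by rewrite occ_hop (negbTE ki) (negbTE kj).
Qed.

(** For two neighbouring sites with occupation numbers a and b, (1 - a)(1 - b) + a + b = 1 + ab;
    this is summed over the ring. *)
Lemma sum_vacant2 x :
  (\sum_i vacant2 x i + 2 * n_particles x = L + \sum_i pair2 x i)%N.
Proof.
have e1 : (\sum_i occ x (ord_pred i) = n_particles x)%N.
  by rewrite /n_particles [RHS](reindex_inj (@ord_pred_inj L)).
have e2 : (\sum_(i < L) 1 = L)%N by rewrite sum1_card card_ord.
suff E : (\sum_i vacant2 x i + (\sum_i occ x (ord_pred i) + \sum_i occ x i) =
          \sum_(i < L) 1 + \sum_i pair2 x i)%N.
  by rewrite e2 e1 in E; rewrite -E mul2n addnn.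
rewrite -!big_split /=.
by apply: eq_bigr => i _; rewrite /vacant2 /pair2; do 2 case: occ.
Qed.

Lemma sum_vacant2_frozen x : frozen x ->
  (\sum_i vacant2 x i + 2 * n_particles x = L)%N.
Proof.
move=> /forallP x0; rewrite sum_vacant2 [X in (_ + X)%N]big1 ?addn0 // => i _.
by rewrite (negbTE (x0 i)).
Qed.

(** * Reaching frozen configurations by hops in one direction [s], later [ordS] or [ord_pred] *)

Section direction.
Variables s t : 'I_L -> 'I_L.
Hypothesis tK : cancel s t.
Hypothesis s_trans : forall i j, exists2 k, (k < L)%N & iter k s i = j.

Let s_inj : injective s. Proof. exact: can_inj tK. Qed.

(** The vacated site [i] lies between [t i], occupied because the hop is facilitated, and [s i],
    just filled; so it belongs to no new pair of holes. *)
Lemma hop_vacant_dir x i k : facil x (t i) i (s i) ->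
  ~~ occ (hop x i (s i)) k && ~~ occ (hop x i (s i)) (s k) ->
  [&& ~~ occ x k, ~~ occ x (s k), k != s i & s k != i].
Proof.
case/and3P=> xh xi xj; rewrite !occ_hop.
have si : s i != i by apply: contraNneq xj => ->.
have [->|ki] := eqVneq k i; first by rewrite (negbTE si) eqxx.
have [->//|ksi] := eqVneq k (s i).
have [ski|ski] := eqVneq (s k) i.
  by move: xh; rewrite -ski tK => ->.
by rewrite (inj_eq s_inj) (negbTE ki) /= => /andP[-> ->].
Qed.

Let holes x := [pred k | ~~ occ x k && ~~ occ x (s k)].

Let ahead x (k : nat) := [exists i, [&& occ x (t i), occ x i,
  ~~ occ x (iter k s i) & ~~ occ x (iter k.+1 s i)]].

Let dist x := find (ahead x) (iota 0 L).

Let dist_le x (k : nat) : (k < L)%N -> ahead x k -> (dist x <= k)%N.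
Proof.
move=> kL xk; rewrite leqNgt; apply/negP => /(before_find 0%N).
by rewrite nth_iota // add0n xk.
Qed.

(* The potential decreases when the pair of particles closest to a pair of
   holes ahead of it (in direction [s]) moves. *)
Let potential x := (#|holes x| * L.+1 + dist x)%N.

Lemma potential_hop x : (exists i, occ x (t i) && occ x i) ->
    (exists k, ~~ occ x k && ~~ occ x (s k)) ->
  exists2 i, facil x (t i) i (s i) & (potential (hop x i (s i)) < potential x)%N.
Proof.
move=> [i0 /andP[i0a i0b]] [j0 /andP[j0a j0b]].
(* This bound makes [potential], with its factor [L.+1], a lexicographic order: first the number of
   pairs of holes, then [dist]. *)
have dL y : (dist y <= L)%N.
  by rewrite -[leqRHS](size_iota 0); exact: find_size.
have xh : has (ahead x) (iota 0 L).
  have [k kL kE] := s_trans i0 j0; apply/hasP; exists k.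
    by rewrite mem_iota add0n.
  by apply/existsP; exists i0; rewrite i0a i0b iterS kE j0a.
have xL : (dist x < L)%N by rewrite -[leqRHS](size_iota 0) -has_find.
have := nth_find 0%N xh; rewrite -/(dist x) nth_iota // add0n.
move=> /existsP[i /and4P[xa xi xk xk1]].
(* Otherwise the pair of particles at [i] and [s i] would be closer to the holes. *)
have xsi : ~~ occ x (s i).
  apply/negP => xsi; case dE : (dist x) xk xk1 => [|k] /= xk xk1.
    by move: xk; rewrite xi.
  have : (dist x <= k)%N; last by rewrite dE ltnn.
  apply: dist_le; first by rewrite dE in xL; exact: ltnW.
  by apply/existsP; exists (s i); rewrite tK xi xsi -!iterSr xk xk1.
have si : s i != i by apply: contraNneq xsi => ->.
have fx : facil x (t i) i (s i) by apply/and3P.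
exists i => //; set y := hop x i (s i).
have sub : holes y \subset holes x.
  apply/fintype.subsetP => k; rewrite !inE => /(hop_vacant_dir fx).
  by case/and4P => -> ->.
(* If [s (s i)] is empty, the hop destroys a pair of holes. Otherwise it creates the pair of
   particles [s i], [s (s i)], two sites closer to the same pair of holes. *)
have [xssi|xssi] := boolP (occ x (s (s i))); last first.
  suff lt : (#|holes y| < #|holes x|)%N.
    rewrite /potential (@leq_trans (#|holes y| * L.+1 + L.+1)%N) //.
      by rewrite addnS ltnS leq_add2l.
    by rewrite addnC -mulSn (leq_trans (leq_mul lt (leqnn _))) ?leq_addr.
  apply/proper_card/properP; split => //; exists (s i); rewrite !inE ?xsi //.
  by rewrite occ_hop (negbTE si) eqxx.
rewrite /potential -addnS leq_add ?leq_mul2r ?(subset_leq_card sub) ?orbT //.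
have ssi : s (s i) != i.
  apply: contraTneq xssi => e; move: xa; rewrite -{1}e tK => xa.
  by rewrite xa in xsi.
case dE : (dist x) xk xk1 xL => [|[|k]] xk xk1 xL; first by rewrite /= xi in xk.
  by rewrite /= xssi in xk1.
rewrite ltnS ltnW // ltnS; apply: dist_le; first by rewrite 2?ltnW.
apply/existsP; exists (s (s i)); rewrite tK -!iterSr !occ_hop.
have ni (l : nat) : ~~ occ x (iter l s i) -> iter l s i != i.
  by apply: contraNneq => ->.
rewrite (negbTE si) eqxx (negbTE ssi) (inj_eq s_inj) (negbTE si) xssi.
rewrite (negbTE (ni _ xk)) (negbTE (ni _ xk1)) .
have -> : (iter k.+2 s i == s i) = false.
  by apply: contraNF xk1 => /eqP e; rewrite iterS e.
have -> : (iter k.+3 s i == s i) = false.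
  by rewrite iterS (inj_eq s_inj); exact/negbTE/ni.
by rewrite xk xk1.
Qed.

Lemma descent_dir : exists d : config L -> nat, forall x,
    (exists i, occ x (t i) && occ x i) ->
    (exists k, ~~ occ x k && ~~ occ x (s k)) ->
  exists2 i, facil x (t i) i (s i) & (d (hop x i (s i)) < d x)%N.
Proof. by exists potential; exact: potential_hop. Qed.

End direction.

Lemma iter_ordS i (k : nat) : val (iter k (@ordS L) i) = ((i + k) %% L)%N.
Proof.
elim: k => [|k IHk]; first by rewrite addn0 modn_small.
by rewrite iterS /= IHk -addn1 modnDml addn1 addnS.
Qed.

Lemma ordS_trans i j : exists2 k, (k < L)%N & iter k (@ordS L) i = j.
Proof.
have L0 : (0 < L)%N by rewrite (leq_ltn_trans _ (ltn_ord i)).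
exists ((j + (L - i)) %% L)%N; first by rewrite ltn_mod.
apply/val_inj; rewrite iter_ordS modnDmr addnCA subnKC; last exact: ltnW.
by rewrite modnDr modn_small.
Qed.

Lemma ord_pred_trans i j : exists2 k, (k < L)%N & iter k (@ord_pred L) i = j.
Proof.
have [k kL <-] := ordS_trans j i; exists k => //.
elim: k {kL} => // k IHk; rewrite iterSr [iter k.+1 _ _]iterS ordSK; exact: IHk.
Qed.

Lemma exists_vacant2 x : (2 * n_particles x < L)%N -> exists i, vacant2 x i.
Proof.
move=> nL; apply/existsP; apply: contraLR nL => /existsPn v0.
have := sum_vacant2 x; rewrite big1 => [|i _]; last by rewrite (negbTE (v0 i)).
by rewrite add0n -leqNgt => ->; exact: leq_addr.
Qed.

Lemma descent_right : exists d : config L -> nat, forall x,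
    ~~ frozen x -> (2 * n_particles x < L)%N ->
  exists2 i, facil x (ord_pred i) i (ordS i) & (d (hop x i (ordS i)) < d x)%N.
Proof.
have [d dP] := descent_dir (@ordSK L) ordS_trans.
exists d => x /forallPn[i /negPn xi] /exists_vacant2[k xk]; apply: dP.
  by exists i.
by exists (ord_pred k); rewrite ord_predK.
Qed.

Lemma descent_left : exists d : config L -> nat, forall x,
    ~~ frozen x -> (2 * n_particles x < L)%N ->
  exists2 i, facil x (ordS i) i (ord_pred i) &
    (d (hop x i (ord_pred i)) < d x)%N.
Proof.
have [d dP] := descent_dir (@ord_predK L) ord_pred_trans.
exists d => x /forallPn[i /negPn xi] /exists_vacant2[k xk]; apply: dP.
  by exists (ord_pred i); rewrite ord_predK andbC.
by exists k; rewrite andbC.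
Qed.

Lemma hop_vacant2_right x i k : facil x (ord_pred i) i (ordS i) ->
  vacant2 (hop x i (ordS i)) k -> vacant2 x k.
Proof.
move=> fx; have := @hop_vacant_dir _ _ (@ordSK L) x i (ord_pred k) fx.
by rewrite ord_predK => H /H /and4P[] *; exact/andP.
Qed.

Lemma hop_vacant2_left x i k : facil x (ordS i) i (ord_pred i) ->
  vacant2 (hop x i (ord_pred i)) k -> vacant2 x k.
Proof.
move=> fx; have := @hop_vacant_dir _ _ (@ord_predK L) x i k fx.
by rewrite /vacant2 andbC => H /H /and4P[] *; exact/andP.
Qed.

(** Hops in both directions are included, even those of rate 0, so that closedness does not depend
    on [p]. *)
Definition hop_closed (S : pred (config L)) := forall x i, S x ->
  (facil x (ord_pred i) i (ordS i) -> S (hop x i (ordS i))) /\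
  (facil x (ordS i) i (ord_pred i) -> S (hop x i (ord_pred i))).

Lemma hop_closed_n (Q : pred nat) : hop_closed [pred x | Q (n_particles x)].
Proof. by move=> x i Qx; split=> fx; rewrite /= (n_particles_hop fx). Qed.

Lemma hop_closedI (S S' : pred (config L)) :
  hop_closed S -> hop_closed S' -> hop_closed [predI S & S'].
Proof.
move=> cS cS' x i /andP[Sx Sx']; have [[c1 c2] [c1' c2']] := (cS x i Sx, cS' x i Sx').
by split=> fx; apply/andP; split; [exact: c1|exact: c1'|exact: c2|exact: c2'].
Qed.

Lemma hop_closed_vacant2 k : hop_closed [pred x | ~~ vacant2 x k].
Proof.
move=> x i /= xk; split=> fx; apply: contra xk.
  exact: hop_vacant2_right.
exact: hop_vacant2_left.
Qed.

End dynamics.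

(** * Harmonic functions *)

Section harmonic.
Variables (R : realType) (L : nat) (p : R).
Hypothesis hp : 0 <= p <= 1.
Implicit Types (x y : config L) (i j k : 'I_L) (f g : config L -> R).

Local Notation G := (generator (@fasep_rate R L p)).

Lemma generatorE f x : G f x = \sum_i
  (p * (facil x (ord_pred i) i (ordS i))%:R * (f (hop x i (ordS i)) - f x)
  + (1 - p) * (facil x (ordS i) i (ord_pred i))%:R *
      (f (hop x i (ord_pred i)) - f x)).
Proof.
rewrite /generator /fasep_rate; under eq_bigr do rewrite mulr_suml.
rewrite exchange_big /=; apply: eq_bigr => i _.
under eq_bigr do rewrite mulrDl.
rewrite big_split /=; congr (_ + _).
  rewrite (bigD1 (hop x i (ordS i))) //= big1 ?addr0; last first.
    by move=> y /negbTE yx; rewrite yx !andbF mulr0n mul0r.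
  by rewrite eqxx andbT mulr_natr.
rewrite (bigD1 (hop x i (ord_pred i))) //= big1 ?addr0; last first.
  by move=> y /negbTE yx; rewrite yx !andbF mulr0n mul0r.
by rewrite eqxx andbT mulr_natr.
Qed.

Lemma generator_frozen f x : frozen x -> G f x = 0.
Proof.
move=> x0; rewrite generatorE big1 // => i _; rewrite /facil.
have [xi|xi] := boolP (occ x i); last by rewrite !andbF !mulr0 !mul0r addr0.
rewrite (frozenP x0 xi) /= !mulr0 !mul0r addr0.
have [xpi|//] := boolP (occ x (ord_pred i)); last by rewrite mulr0 mul0r.
by move: (frozenP x0 xpi); rewrite ord_predK xi.
Qed.

Lemma generatorD f g x : G (fun y => f y + g y) x = G f x + G g x.
Proof.
by rewrite /generator -big_split /=; apply: eq_bigr => y _; ring.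
Qed.

Lemma generatorZ a f x : G (fun y => a * f y) x = a * G f x.
Proof. by rewrite /generator big_distrr /=; apply: eq_bigr => y _; ring. Qed.

Lemma generator_sum (I : Type) (r : seq I) (P : pred I) (F : I -> config L -> R) x :
  G (fun y => \sum_(i <- r | P i) F i y) x = \sum_(i <- r | P i) G (F i) x.
Proof.
rewrite /generator exchange_big /=; apply: eq_bigr => y _.
by rewrite -sumrB mulr_sumr.
Qed.

(** Among the points of [S] where [f] attains a positive maximum, take one with the least descent
    potential [d]. It is not frozen, and there [0 <= G f] forces [f] to keep its value along every
    hop of positive rate; one of these hops lowers [d], a contradiction. *)
Lemma maximum_principle (S : pred (config L)) f :
    hop_closed S -> (forall x, S x -> (2 * n_particles x < L)%N) ->
    (forall x, S x -> ~~ frozen x -> 0 <= G f x) ->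
    (forall x, S x -> frozen x -> f x <= 0) ->
  forall x, S x -> f x <= 0.
Proof.
move=> cS nS Gf f0 x0 Sx0; rewrite leNgt; apply/negP => fx0.
pose x1 := [arg max_(x > x0 | S x) f x]%O.
have [Sx1 mx1] : S x1 /\ forall x, S x -> f x <= f x1.
  by rewrite /x1; case: arg_maxP.
have fx1 : 0 < f x1 := lt_le_trans fx0 (mx1 _ Sx0).
have [d dP] : exists d : config L -> nat, forall x, ~~ frozen x ->
    (2 * n_particles x < L)%N -> exists i,
    (0 < p /\ facil x (ord_pred i) i (ordS i) /\ (d (hop x i (ordS i)) < d x)%N)
 \/ (0 < 1 - p /\ facil x (ordS i) i (ord_pred i) /\
      (d (hop x i (ord_pred i)) < d x)%N).
  have [p0|p0] := ltP 0 p.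
    have [d dP] := descent_right L; exists d => x x0' xn.
    by have [i *] := dP x x0' xn; exists i; left.
  have [d dP] := descent_left L; exists d => x x0' xn.
  by have [i *] := dP x x0' xn; exists i; right; split => //; lra.
pose S1 x := S x && (f x == f x1).
pose x2 := [arg min_(x < x1 | S1 x) d x].
have [/andP[Sx2 /eqP fx2] mx2] : S1 x2 /\ forall x, S1 x -> (d x2 <= d x)%N.
  by rewrite /x2; case: arg_minnP => //; rewrite /S1 Sx1 eqxx.
have nf : ~~ frozen x2.
  by apply/negP => /(f0 _ Sx2); rewrite fx2 leNgt fx1.
have [i hi] := dP _ nf (nS _ Sx2).
have [/andP[p0 p1]] := (hp, Gf _ Sx2 nf).
set a := fun i => p * (facil x2 (ord_pred i) i (ordS i))%:R * (f (hop x2 i (ordS i)) - f x2).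
set b := fun i => (1 - p) * (facil x2 (ordS i) i (ord_pred i))%:R *
      (f (hop x2 i (ord_pred i)) - f x2).
have a0 j : a j <= 0.
  rewrite /a; case: (boolP (facil _ _ _ _)) => fa; last by rewrite mulr0 mul0r.
  rewrite mulr1 mulr_ge0_le0 // subr_le0 fx2 mx1 //.
  exact: (cS _ _ Sx2).1.
have b0 j : b j <= 0.
  rewrite /b; case: (boolP (facil _ _ _ _)) => fa; last by rewrite mulr0 mul0r.
  rewrite mulr1 mulr_ge0_le0 ?subr_ge0 // subr_le0 fx2 mx1 //.
  exact: (cS _ _ Sx2).2.
rewrite generatorE -/a -/b => sum0.
have ab0 : a i + b i = 0.
  have ab j : a j + b j <= 0 by have := a0 j; have := b0 j; lra.
  apply/eqP; rewrite eq_le ab /=; apply: le_trans sum0 _.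
  rewrite (bigD1 i) //= -[leRHS]addr0 lerD2l; by apply: sumr_le0 => j _; exact: ab.
case: hi => [[pp [fa da]]|[pp [fa da]]].
  have ai : a i = 0 by have := a0 i; have := b0 i; lra.
  have Sy : S (hop x2 i (ordS i)) by exact: (cS _ _ Sx2).1.
  move: da; rewrite ltnNge mx2 // /S1 Sy /=.
  move: ai; rewrite /a fa mulr1 => /eqP; rewrite mulf_eq0 gt_eqF //= subr_eq0 fx2.
  by [].
have bi : b i = 0 by have := a0 i; have := b0 i; lra.
have Sy : S (hop x2 i (ord_pred i)) by exact: (cS _ _ Sx2).2.
move: da; rewrite ltnNge mx2 // /S1 Sy /=.
move: bi; rewrite /b fa mulr1 => /eqP; rewrite mulf_eq0 gt_eqF //= subr_eq0 fx2.
by [].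
Qed.

Lemma harmonic_unique (S : pred (config L)) f :
    hop_closed S -> (forall x, S x -> (2 * n_particles x < L)%N) ->
    (forall x, S x -> ~~ frozen x -> G f x = 0) ->
    (forall x, S x -> frozen x -> f x = 0) ->
  forall x, S x -> f x = 0.
Proof.
move=> cS nS Gf f0 x Sx; apply/eqP; rewrite eq_le; apply/andP; split.
  apply: (maximum_principle cS nS) Sx => y Sy fy; first by rewrite Gf.
  by rewrite f0.
rewrite -oppr_le0 -mulN1r.
apply: (@maximum_principle _ (fun y => -1 * f y) cS nS) Sx => y Sy fy.
  by rewrite generatorZ Gf // mulr0.
by rewrite f0 // mulr0.
Qed.

(** Configurations with at least L/2 particles may never be absorbed. Counting them as boundary
    makes the Dirichlet problem well posed on the whole space of configurations. *)
Definition transient x := ~~ frozen x && (2 * n_particles x < L)%N.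

Lemma dirichlet_unique f :
    (forall x, transient x -> G f x = 0) -> (forall x, ~~ transient x -> f x = 0) ->
  forall x, f x = 0.
Proof.
move=> Gf f0 x; have [xn|xn] := boolP (2 * n_particles x < L)%N; last first.
  by apply: f0; rewrite /transient (negbTE xn) andbF.
apply: (@harmonic_unique [pred x | 2 * n_particles x < L]%N) xn => //.
- by move=> y i yn; split=> fy /=; rewrite (n_particles_hop fy).
- by move=> y yn fy; rewrite Gf // /transient fy.
- by move=> y yn fy; rewrite f0 // /transient fy.
Qed.

(** This is a square linear system, injective by [dirichlet_unique] and therefore surjective. *)
Lemma dirichlet_exists (b : config L -> R) : exists f,
  (forall x, transient x -> G f x = b x) /\ (forall x, ~~ transient x -> f x = b x).
Proof.
pose V := {ffun config L -> R^o}.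
pose A (v : V) : V := [ffun x => if transient x then G v x else v x].
have Alin : linear A.
  move=> a u v; apply/ffunP => x; rewrite !ffunE; case: ifP => // _.
  transitivity (a * G u x + G v x) => //.
  rewrite -generatorZ -generatorD /generator; apply: eq_bigr => y _.
  by rewrite !ffunE.
pose Al := GRing.isLinear.Build R V V _ A Alin.
pose A' : {linear V -> V} := HB.pack A Al.
pose h := linfun A'.
have k0 : lker h == 0%VS.
  rewrite -subv0; apply/subvP => v; rewrite memv_ker memv0 lfunE /= => /eqP Av.
  apply/eqP/ffunP => x; rewrite ffunE.
  have Ay y : (if transient y then G v y else v y) = 0.
    by have := congr1 (fun u : V => u y) Av; rewrite !ffunE.
  apply: (@dirichlet_unique v) => y; first by have := Ay y; case: ifP.
  by have := Ay y; case: ifP.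
have : [ffun x => b x] \in limg h by rewrite (lker0_limgf k0) memvf.
case/memv_imgP => v _; rewrite lfunE /= => bE.
exists v; split => x tx; have := congr1 (fun u : V => u x) bE; rewrite !ffunE.
  by rewrite tx => ->.
by rewrite (negbTE tx) => ->.
Qed.

End harmonic.

(** * Absorption probabilities and their rotation invariance *)

Section hitting.
Variables (R : realType) (p : R).
Hypothesis hp : 0 <= p <= 1.

Definition is_hitting L (z : config L) (f : config L -> R) :=
  (forall x, transient x -> generator (fasep_rate p) f x = 0) /\
  (forall x, ~~ transient x -> f x = (x == z)%:R).

(* For frozen [z], the probability that the process started at [x] is absorbed
   at [z]. *)
Definition hit L (z : config L) : config L -> R := xget (fun=> 0) (is_hitting z).

Section ring.
Variable L : nat.
Implicit Types (x y z : config L) (i j k : 'I_L).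

Local Notation G := (generator (@fasep_rate R L p)).

Lemma hitP z : is_hitting z (hit z).
Proof.
have [f [f1 f2]] := dirichlet_exists hp (fun x => (~~ transient x && (x == z))%:R : R).
suff fP : is_hitting z f by exact: (xgetPex _ (ex_intro _ f fP)).
by split=> x tx; [rewrite f1 ?tx|rewrite f2 ?tx].
Qed.

Lemma hit_unique z f : is_hitting z f -> hit z = f.
Proof.
move=> [f1 f2]; have [h1 h2] := hitP z; apply/funext => x; apply/eqP.
rewrite -subr_eq0; apply/eqP; move: x.
suff H x : hit z x + -1 * f x = 0 by move=> x; have := H x; rewrite mulN1r.
apply: (dirichlet_unique hp (f := fun x => hit z x + -1 * f x)) => {}x tx.
  by rewrite generatorD generatorZ h1 // f1 // mulr0 addr0.
by rewrite h2 // f2 // mulN1r subrr.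
Qed.

Lemma frozen_transient x : frozen x -> ~~ transient x.
Proof. by rewrite /transient => ->. Qed.

Lemma hit_frozen z x : frozen x -> hit z x = (x == z)%:R.
Proof. by move=> x0; rewrite (hitP z).2 // frozen_transient. Qed.

(** The boundary values vanish on [S], so uniqueness applies within [S]. Conservation of particles
    and the impossibility of creating pairs of holes are both exploited through this lemma. *)
Lemma hit_closed z (S : pred (config L)) x : hop_closed S -> ~~ S z -> S x ->
  hit z x = 0.
Proof.
move=> cS zS Sx; have [xn|xn] := boolP (2 * n_particles x < L)%N; last first.
  rewrite (hitP z).2 ?/transient ?(negbTE xn) ?andbF //.
  by case: eqVneq => // xz; rewrite -xz Sx in zS.
have cn : hop_closed [predI S & [pred y | 2 * n_particles y < L]%N].
  exact/hop_closedI/(@hop_closed_n L (fun n => 2 * n < L)%N).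
apply: (harmonic_unique hp cn) => [y /andP[]//|y /andP[Sy yn] fy|y /andP[Sy yn] fy|].
- by rewrite (hitP z).1 // /transient fy.
- by rewrite hit_frozen //; case: eqVneq => // yz; rewrite -yz (Sy : S y) in zS.
- exact/andP.
Qed.

Lemma hit_neq0_n z x : hit z x != 0 -> n_particles x = n_particles z.
Proof.
move=> zx; apply/eqP; apply: contraNT zx => xz; apply/eqP.
by apply: hit_closed (@hop_closed_n L (predC1 (n_particles z))) _ _; rewrite /= ?eqxx.
Qed.

Lemma hit_neq0_vacant2 z x k : hit z x != 0 -> vacant2 z k -> vacant2 x k.
Proof.
move=> zx zk; apply: contraNT zx => xk; apply/eqP.
by apply: hit_closed (@hop_closed_vacant2 L k) _ _; rewrite //= zk.
Qed.

Lemma generator_closed0 (S : pred (config L)) f x :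
  hop_closed S -> (forall y, S y -> f y = 0) -> S x -> G f x = 0.
Proof.
move=> cS f0 Sx; rewrite generatorE big1 // => i _; rewrite (f0 x) // !subr0.
have [c1 c2] := cS x i Sx.
by case: (boolP (facil x _ _ _)) => [/c1/f0 ->|_];
   case: (boolP (facil x _ _ _)) => [/c2/f0 ->|_]; rewrite !(mulr0, mul0r) addr0.
Qed.

(** The equation is needed at the boundary too, for the expectation of [hit z] to be constant in
    time. The generator vanishes at frozen configurations, and [hit z] vanishes on the closed set of
    configurations with at least L/2 particles. *)
Lemma hit_harmonic z x : (2 * n_particles z < L)%N -> G (hit z) x = 0.
Proof.
move=> zn; have [/(hitP z).1//|] := boolP (transient x).
rewrite /transient negb_and negbK => /orP[/generator_frozen//|xn].
apply: (generator_closed0 (S := [pred y | ~~ (2 * n_particles y < L)]%N)) => //.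
  exact: (@hop_closed_n L (fun n => ~~ (2 * n < L)%N)).
move=> y yn; apply/eqP; apply: contraNT yn => /hit_neq0_n.
by rewrite /= => ->.
Qed.

(** The sum minus 1 is harmonic on the sector and vanishes at its frozen configurations. *)
Lemma sum_hit N x : (2 * N < L)%N -> n_particles x = N ->
  \sum_(z | frozen z && (n_particles z == N)) hit z x = 1.
Proof.
move=> NL xN; apply/eqP; rewrite -subr_eq0; apply/eqP.
apply: (harmonic_unique hp (@hop_closed_n L (pred1 N)) (f :=
  fun x => \sum_(z | frozen z && (n_particles z == N)) hit z x - 1)) => [y|y|y|].
- by move=> /eqP ->.
- move=> /eqP yN fy; rewrite generatorD generator_sum big1 ?add0r.
    by rewrite /generator big1 // => w _; rewrite subrr mulr0.
  by move=> z /andP[_ /eqP zN]; rewrite hit_harmonic ?zN.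
- move=> /= yN fy; rewrite (bigD1 y) ?fy //= hit_frozen // eqxx big1 ?addr0 ?subrr //.
  move=> z /andP[/andP[fz _] zy]; rewrite hit_frozen // eq_sym.
  by rewrite (negbTE zy).
- by rewrite /= xN.
Qed.

Lemma occ_tau x i : occ (tau x) i = occ x (ord_pred i).
Proof. exact: occ_mk. Qed.

Lemma n_particles_tau x : n_particles (tau x) = n_particles x.
Proof.
rewrite /n_particles [RHS](reindex_inj (@ord_pred_inj L)).
by apply: eq_bigr => i _; rewrite occ_tau.
Qed.

Lemma vacant2_tau x i : vacant2 (tau x) (ordS i) = vacant2 x i.
Proof. by rewrite /vacant2 !occ_tau ordSK. Qed.

Lemma frozen_tau x : frozen (tau x) = frozen x.
Proof.
apply/forallP/forallP => H i; last by rewrite /pair2 !occ_tau; exact: H.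
by have := H (ordS i); rewrite /pair2 !occ_tau ordSK.
Qed.

Lemma tau_inj : injective (@tau L).
Proof.
move=> x y xy; apply/config_eqP => i.
by rewrite -[i]ordSK -!occ_tau xy.
Qed.

Lemma hop_tau x i j : hop (tau x) (ordS i) (ordS j) = tau (hop x i j).
Proof.
apply/config_eqP => k; rewrite occ_hop !occ_tau occ_hop.
by rewrite -{1 2}[k]ord_predK !(inj_eq (@ordS_inj L)).
Qed.

Lemma generator_tau f x : G f (tau x) = G (fun y => f (tau y)) x.
Proof.
rewrite !generatorE (reindex_inj (@ordS_inj L)); apply: eq_bigr => i _.
have ft h j : facil (tau x) (ordS h) (ordS i) (ordS j) = facil x h i j.
  by rewrite /facil !occ_tau !ordSK.
by rewrite ordSK -{2 4}[i]ord_predK -ft -!hop_tau ord_predK -ft ord_predK.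
Qed.

Lemma hit_tau z x : hit (tau z) (tau x) = hit z x.
Proof.
rewrite (@hit_unique z (fun x => hit (tau z) (tau x))) //; split=> y ty.
  by rewrite -generator_tau (hitP _).1 // /transient frozen_tau n_particles_tau.
rewrite (hitP _).2 ?(inj_eq tau_inj) //.
by rewrite /transient frozen_tau n_particles_tau.
Qed.

(* Up to the size of the sector, the probability of absorption at [z] from the
   uniform distribution. *)
Definition mass z := \sum_x hit z x.

Lemma mass_tau z : mass (tau z) = mass z.
Proof.
by rewrite /mass (reindex_inj tau_inj); apply: eq_bigr => x _; rewrite hit_tau.
Qed.

Lemma sum_mass N : (2 * N < L)%N ->
  \sum_(z | frozen z && (n_particles z == N)) mass z = #|sector L N|%:R.
Proof.
move=> NL; rewrite exchange_big /= -sum1_card natr_sum [RHS]big_mkcond /=.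
apply: eq_bigr => x _; rewrite inE; case: eqVneq => [xN|xN]; first exact: sum_hit.
rewrite big1 // => z /andP[_ /eqP zN]; apply/eqP; apply: contraNT xN.
by move=> /hit_neq0_n; rewrite zN => ->.
Qed.

(** By rotation invariance the sum is the same for every [k], and adding over all [k] counts each
    [z] once for each of its L - 2N pairs of holes. *)
Lemma sum_mass_vacant2 N k : (2 * N < L)%N ->
  L%:R * (\sum_(z | [&& frozen z, n_particles z == N & vacant2 z k]) mass z) =
  (L - 2 * N)%:R * #|sector L N|%:R.
Proof.
move=> NL; pose F j := \sum_(z | [&& frozen z, n_particles z == N & vacant2 z j]) mass z.
have FS j : F (ordS j) = F j.
  rewrite /F (reindex_inj tau_inj); apply: eq_big => z.
    by rewrite frozen_tau n_particles_tau vacant2_tau.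
  by rewrite mass_tau.
have Fk j : F j = F k.
  have [l _ <-] := ordS_trans k j.
  by elim: l => // l IHl; rewrite iterS FS.
rewrite -/(F k) -sum_mass //.
transitivity (\sum_(j < L) F j).
  rewrite (_ : \sum_(j < L) F j = \sum_(j < L) F k); last by apply: eq_bigr => j _.
  by rewrite [RHS]sumr_const card_ord mulr_natl.
rewrite /F; under eq_bigr do rewrite big_mkcond /=.
rewrite exchange_big /= mulr_sumr [RHS]big_mkcond /=; apply: eq_bigr => z _.
have [/andP[fz /eqP zN]|/negbTE zz] := boolP (frozen z && (n_particles z == N)).
  have -> : (L - 2 * N = \sum_j vacant2 z j)%N.
    by have := sum_vacant2_frozen fz; rewrite zN; lia.
  rewrite fz zN eqxx /= natr_sum mulr_suml.
  by apply: eq_bigr => j _; case: vacant2; rewrite ?mul1r ?mul0r.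
by rewrite big1 // => j _; rewrite andbA zz.
Qed.

End ring.
End hitting.

(** * Block decomposition *)

(** Distributivity in dependent form, since the blocks of a configuration have different lengths. *)
Lemma big_fprod_distr (R : comPzSemiRingType) (I : finType) (T : I -> finType)
    (F : forall i, T i -> R) :
  \sum_(t : fprod T) \prod_i F i (t i) = \prod_i \sum_(u : T i) F i u.
Proof.
transitivity (\sum_(t : fprod T) \prod_(i in I) [ffun u => F i u] (t i)).
  by apply: eq_bigr => t _; apply: eq_bigr => i _; rewrite ffunE.
rewrite big_fprod.
apply: etrans (esym (bigA_distr_big_dep (tagged_with T)
  (fun i => untag 0 [ffun u => F i u]))) _.
apply: eq_bigr => i _.
rewrite [RHS](big_tag F); apply: eq_bigr => u /eqP ui.
by rewrite !untagE /= ffunE.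
Qed.

Section blocks.
Variables (R : realType) (p : R).
Hypothesis hp : 0 <= p <= 1.
Variables (L : nat) (J : finType) (l : J -> nat) (e : forall j, 'I_(l j) -> 'I_L).
Hypothesis l_gt0 : forall j, (0 < l j)%N.
Hypothesis e_bij : bijective (fun u : {j & 'I_(l j)} => e (tagged u)).
Hypothesis e_pred : forall j (k : 'I_(l j)), val k != 0%N ->
  ord_pred (e k) = e (ord_pred k).
Implicit Types (x y z : config L).

Let eTag j j' (k : 'I_(l j)) (k' : 'I_(l j')) : e k = e k' ->
  Tagged (fun j => 'I_(l j)) k = Tagged (fun j => 'I_(l j)) k'.
Proof. by move=> ekk; apply: (bij_inj e_bij). Qed.

Let e_inj j : injective (@e j).
Proof. by move=> k k' /eTag /eqP; rewrite eq_Tagged /= => /eqP. Qed.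

Let e_surj i : exists j (k : 'I_(l j)), i = e k.
Proof.
have [g _ gK] := e_bij; exists (tag (g i)), (tagged (g i)).
by rewrite -[LHS]gK.
Qed.

Let e_ordS j (k : 'I_(l j)) : val (ordS k) != 0%N -> ordS (e k) = e (ordS k).
Proof. by move=> /e_pred; rewrite ordSK => <-; rewrite ord_predK. Qed.

(** Here [e k] is the [k]-th site of block [j], and [ord_pred k] is the last index of the block
    since indices are cyclic. A site that does not start a block has its predecessor in its own
    block, so what follows the end of a block is the start of one. *)
Let e_ordS_last j (k : 'I_(l j)) : val k = 0%N ->
  exists j' (k' : 'I_(l j')), val k' = 0%N /\ ordS (e (ord_pred k)) = e k'.
Proof.
move=> k0; have [j' [k' kE]] := e_surj (ordS (e (ord_pred k))).
exists j', k'; split=> //; apply/eqP/contraT => k'0.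
have := e_pred k'0; rewrite -kE ordSK => /eTag.
move=> /(congr1 (fun u : {j & 'I_(l j)} => val (ordS (tagged u)))) k'E.
have {}k'E : val (ordS (ord_pred k)) = val (ordS (ord_pred k')) by [].
by move: k'0; rewrite !ord_predK in k'E; rewrite -k'E k0.
Qed.

Let e_ord_pred0 j (k : 'I_(l j)) : val k = 0%N ->
  exists j' (k' : 'I_(l j')), val k' = 0%N /\ ord_pred (e k) = e (ord_pred k').
Proof.
move=> k0; have [j' [k' kE]] := e_surj (ord_pred (e k)).
exists j', (ordS k'); split; last by rewrite ordSK.
apply/eqP/contraT => k'0; have := e_ordS k'0; rewrite -kE ord_predK => /eTag.
move=> /(congr1 (fun u : {j & 'I_(l j)} => val (tagged u))) k'E.
have {}k'E : val k = val (ordS k') by [].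
by move: k'0; rewrite -k'E k0.
Qed.

(** The block is closed up into a ring of its own: its last and first sites become neighbours. *)
Definition restr j x : config (l j) := mk_config (fun k => occ x (e k)).
Let hole_starts x := [forall j, forall k : 'I_(l j), (val k == 0%N) ==> vacant2 x (e k)].

Let hole_startsP x : reflect (forall j (k : 'I_(l j)), val k = 0%N -> vacant2 x (e k))
  (hole_starts x).
Proof.
apply: (iffP forallP) => [H j k k0|H j].
  by have /forallP/(_ k)/implyP := H j; apply; apply/eqP.
by apply/forallP => k; apply/implyP => /eqP; exact: H.
Qed.

Lemma restr_inj x y : (forall j, restr j x = restr j y) -> x = y.
Proof.
move=> xy; apply/config_eqP => i; have [j [k ->]] := e_surj i.
by have := congr1 (fun w => occ w k) (xy j); rewrite !occ_mk.
Qed.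

Lemma n_particles_restr x : n_particles x = (\sum_j n_particles (restr j x))%N.
Proof.
rewrite /n_particles sig_big_dep /= (reindex _ (onW_bij _ e_bij)).
by apply: eq_bigr => u _; rewrite occ_mk.
Qed.

(** The last site of the block is empty because it precedes the start of a block, where [x] has a
    pair of holes. *)
Let restr_vacant2 x j (k : 'I_(l j)) : hole_starts x -> val k = 0%N ->
  vacant2 (restr j x) k.
Proof.
move=> /hole_startsP sx k0; rewrite /vacant2 !occ_mk.
have /andP[_ ->] := sx j k k0; rewrite andbT.
have [j' [k' [k'0 kE]]] := e_ordS_last k0.
by have := sx _ _ k'0; rewrite -kE /vacant2 ordSK => /andP[].
Qed.

Let restr_frozen x j : hole_starts x -> frozen x -> frozen (restr j x).
Proof.
move=> sx /forallP fx; apply/forallP => k; rewrite /pair2.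
have [k0|k0] := eqVneq (val k) 0%N.
  by have /andP[_ /negbTE ->] := restr_vacant2 sx k0; rewrite andbF.
by have := fx (e k); rewrite /pair2 e_pred // !occ_mk.
Qed.

Variable z : config L.
Hypotheses (fz : frozen z) (zn : (2 * n_particles z < L)%N).
Hypothesis sz : forall j (k : 'I_(l j)), val k = 0%N -> vacant2 z (e k).

Let sz' : hole_starts z. Proof. exact/hole_startsP. Qed.

(** The pair of holes formed when the block is closed up keeps its density below 1/2, so the theory
    of [hit] applies on the small ring. *)
Let zjn j : (2 * n_particles (restr j z) < l j)%N.
Proof.
have := sum_vacant2_frozen (restr_frozen j sz' fz); set s := (\sum_i _)%N.
suff : (0 < s)%N by lia.
rewrite /s (bigD1 (Ordinal (l_gt0 j))) //=.
by rewrite (restr_vacant2 sz').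
Qed.

Let H x := \prod_j hit p (restr j z) (restr j x).

Let H_hole_starts x : H x != 0 -> hole_starts x.
Proof.
move=> /prodf_neq0 Hx.
have vx j (k : 'I_(l j)) : val k = 0%N -> vacant2 (restr j x) k.
  by move=> k0; exact: (hit_neq0_vacant2 hp (Hx j isT)) (restr_vacant2 sz' k0).
apply/hole_startsP => j k k0; have := vx _ _ k0; rewrite /vacant2 !occ_mk.
move=> /andP[_ ->]; rewrite andbT; have [j' [k' [k'0 ->]]] := e_ord_pred0 k0.
by have := vx _ _ k'0; rewrite /vacant2 !occ_mk => /andP[].
Qed.

Let H_n x : H x != 0 -> n_particles x = n_particles z.
Proof.
move=> /prodf_neq0 Hx; rewrite !n_particles_restr; apply: eq_bigr => j _.
exact: (hit_neq0_n hp (Hx j isT)).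
Qed.

Let restr_hop x j (k k' : 'I_(l j)) : restr j (hop x (e k) (e k')) = hop (restr j x) k k'.
Proof.
by apply/config_eqP => i; rewrite !(occ_mk, occ_hop) !(inj_eq (@e_inj j)).
Qed.

Let restr_hop_neq x j j' (k k' : 'I_(l j)) : j' != j ->
  restr j' (hop x (e k) (e k')) = restr j' x.
Proof.
move=> jj; apply/config_eqP => i; rewrite !(occ_mk, occ_hop).
have ne (k1 : 'I_(l j)) : (e i == e k1) = false.
  by apply: contra_neqF jj => /eqP /eTag /(congr1 tag).
by rewrite !ne.
Qed.

(* While every block starts with a hole preceded by a hole, both end sites of
   every block are empty, so that no hop involves two blocks; as soon as this
   fails, it fails forever and [H] vanishes. *)
Let H_harmonic x : generator (fasep_rate p) H x = 0.
Proof.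
have [sx|sx] := boolP (hole_starts x); last first.
  move: sx; rewrite negb_forall => /existsP[j].
  rewrite negb_forall => /existsP[k]; rewrite negb_imply => /andP[/eqP k0 kx].
  apply: (generator_closed0 p (@hop_closed_vacant2 L (e k))) kx => y yk.
  apply/eqP; apply: contraNT yk => /H_hole_starts/hole_startsP; exact.
rewrite generatorE (reindex _ (onW_bij _ e_bij)) /=.
pose C j := \prod_(j' | j' != j) hit p (restr j' z) (restr j' x).
transitivity (\sum_j C j *
    generator (fasep_rate p) (hit p (restr j z)) (restr j x)); last first.
  by rewrite big1 // => j _; rewrite hit_harmonic // mulr0.
under [RHS]eq_bigr do rewrite generatorE mulr_sumr.
rewrite sig_big_dep /=; apply: eq_bigr => -[j k] _ /=.
have [xk|xk] := boolP (occ x (e k)); last first.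
  by rewrite /facil !occ_mk (negbTE xk) !andFb !andbF !(mulr0, mul0r, addr0).
have k0 : val k != 0%N.
  apply: contraTneq xk => k0; have /hole_startsP/(_ j k k0) := sx.
  by case/andP.
have k1 : val (ordS k) != 0%N.
  apply: contraTneq xk => k1; have := restr_vacant2 sx k1.
  by rewrite /vacant2 ordSK occ_mk => /andP[].
have HE k' : H (hop x (e k) (e k')) = C j * hit p (restr j z) (hop (restr j x) k k').
  rewrite /H (bigD1 j) //= restr_hop mulrC; congr (_ * _).
  by apply: eq_bigr => j' jj; rewrite restr_hop_neq.
have HxE : H x = C j * hit p (restr j z) (restr j x).
  by rewrite /H (bigD1 j) //= mulrC.
rewrite (e_pred k0) (e_ordS k1) !HE HxE /facil !occ_mk; ring.
Qed.

Lemma hit_blocks x : hit p z x = \prod_j hit p (restr j z) (restr j x).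
Proof.
rewrite (@hit_unique _ _ hp _ z H) //; split=> {}x; first by rewrite H_harmonic.
have Hz : H z = 1.
  by rewrite /H big1 // => j _; rewrite hit_frozen ?eqxx // restr_frozen.
have [->|xz tx] := eqVneq x z; first by rewrite Hz.
apply/eqP; apply: contraNT xz => Hx; apply/eqP/restr_inj => j.
(* Where [H x] is nonzero, [x] has as many particles as [z], so being outside the transient set
   means being frozen. *)
have fx : frozen x.
  by apply: contraNT tx; rewrite /transient => ->; rewrite (H_n Hx).
have /prodf_neq0/(_ j isT) := Hx.
rewrite hit_frozen ?restr_frozen ?H_hole_starts //.
by case: (eqVneq (restr j x) (restr j z)) => // _; rewrite eqxx.
Qed.

Lemma mass_blocks : mass p z = \prod_j mass p (restr j z).
Proof.
rewrite /mass -big_fprod_distr; under eq_bigr do rewrite hit_blocks.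
pose F x : fprod (fun j => config (l j)) := [fprod j => restr j x].
have [g gK Kg] := e_bij.
pose F' (t : fprod (fun j => config (l j))) : config L :=
  mk_config (fun i => occ (t (tag (g i))) (tagged (g i))).
have FK : cancel F F'.
  move=> x; apply/config_eqP => i; rewrite occ_mk fprodE occ_mk.
  by rewrite -[in RHS](Kg i).
have F'K : cancel F' F.
  move=> t; apply/fprodP => j; rewrite fprodE; apply/config_eqP => k.
  by rewrite !occ_mk (gK (Tagged _ k)).
rewrite [RHS](reindex F); last by exists F' => ? _; [exact: FK|exact: F'K].
by apply: eq_bigr => x _; apply: eq_bigr => j _; rewrite fprodE.
Qed.

End blocks.

(** * The configurations of the tuples q *)

Lemma val_ord_pred L (i : 'I_L) : val i != 0%N -> val (ord_pred i) = (val i).-1.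
Proof.
by case: i => [[//|i] iL] _; rewrite /= modnDr modn_small // ltnW.
Qed.

Lemma sum_odd n : (\sum_(k < n.*2.+1) odd k = n)%N.
Proof.
elim: n => [|n IHn]; first by rewrite big_ord_recr big_ord0.
by rewrite doubleS big_ord_recr big_ord_recr IHn /= negbK odd_double addn0 addn1.
Qed.

Definition zigzag n : config n.*2.+1 := mk_config (fun k => odd k).

Lemma n_particles_zigzag n : n_particles (zigzag n) = n.
Proof. by rewrite -[RHS]sum_odd; apply: eq_bigr => k _; rewrite occ_mk. Qed.

Lemma size_block n : size (block n) = n.*2.+1.
Proof.
rewrite size_rcons; congr S; elim: n => //= n ->.
by rewrite doubleS.
Qed.

Lemma nth_block n k : nth false (block n) k = ~~ odd k && (k < n.*2)%N.
Proof.
elim: n k => [|n IHn] [|[|k]] //; first by rewrite nth_default ?andbF.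
by rewrite [LHS]IHn /= negbK doubleS.
Qed.

Section words.
Variables L N : nat.
Hypothesis hN : (2 * N < L)%N.
Local Notation m := (L - 2 * N)%N.
Implicit Type q : m.-tuple 'I_L.

Lemma qv_end q : qv q m = L.
Proof. by rewrite /qv nth_default // size_map size_tuple. Qed.

Lemma qv_nth q i (im : (i < m)%N) : qv q i = tnth q (Ordinal im).
Proof.
rewrite /qv (nth_map (tnth q (Ordinal im))) ?size_tuple //.
by rewrite [in RHS](tnth_nth (tnth q (Ordinal im))).
Qed.

Lemma qv_lt q i j : sorted ltn (map val q) -> (i < j <= m)%N -> (qv q i < qv q j)%N.
Proof.
move=> qs /andP[ij]; rewrite leq_eqVlt => /orP[/eqP jm|jm].
  by rewrite jm qv_end qv_nth ?ltn_ord // -jm.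
apply: (sorted_ltn_nth ltn_trans) => //; rewrite inE size_map size_tuple //.
exact: ltn_trans jm.
Qed.

Lemma qv_le q i j : sorted ltn (map val q) -> (i <= j <= m)%N -> (qv q i <= qv q j)%N.
Proof.
move=> qs /andP[]; rewrite leq_eqVlt => /orP[/eqP -> //|ij jm].
by rewrite ltnW // qv_lt // ij.
Qed.

Lemma qv_bracket q v : qv q 0 = 0%N -> (v < L)%N ->
  exists2 i, (i < m)%N & (qv q i <= v < qv q i.+1)%N.
Proof.
move=> q0; rewrite -{1}(qv_end q).
have : (m <= m)%N by [].
elim: {1 3}m => [|n IHn] nm; first by rewrite q0.
have [vn _|nv vSn] := ltnP v (qv q n); first exact: IHn (ltnW nm) vn.
by exists n => //; rewrite nv.
Qed.

Section admissible.
Variable q : m.-tuple 'I_L.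
Hypothesis qa : admissible q.

Let q0 : qv q 0 = 0%N. Proof. by have /and3P[/eqP] := qa. Qed.
Let qs : sorted ltn (map val q). Proof. by have /and3P[] := qa. Qed.

Definition block_size (j : 'I_m) := (gap_index q j).*2.+1.

Lemma qvS i : (i < m)%N -> qv q i.+1 = (qv q i + (gap_index q i).*2.+1)%N.
Proof.
move=> im; have /and3P[_ _ /forallP/(_ (Ordinal im)) /= qo] := qa.
have lt : (qv q i < qv q i.+1)%N by rewrite qv_lt // leqnn.
by move: qo lt; rewrite /gap_index; lia.
Qed.

Lemma nth_word i k : (i < m)%N -> (k <= (gap_index q i).*2)%N ->
  nth false (word q) (qv q i + k) = ~~ odd k && (k < (gap_index q i).*2)%N.
Proof.
move=> im ki.
have size_pre j : (j <= m)%N ->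
    size (flatten [seq block (gap_index q i) | i <- iota 0 j]) = qv q j.
  elim: j => [|j IHj] jm; first by rewrite q0.
  rewrite -addn1 iotaD map_cat flatten_cat size_cat IHj 1?ltnW //= cats0 add0n.
  by rewrite size_block addn1 [RHS]qvS.
rewrite /word -(subnKC (ltnW im)) iotaD map_cat flatten_cat nth_cat.
rewrite (size_pre _ (ltnW im)) (_ : (_ + k < _)%N = false); last by lia.
rewrite addKn.
have -> : (m - i = (m - i).-1.+1)%N by lia.
by rewrite /= add0n nth_cat size_block ltnS ki nth_block.
Qed.

Lemma site_subproof (j : 'I_m) (k : 'I_(block_size j)) : (qv q j + k < L)%N.
Proof.
have : (qv q j.+1 <= qv q m)%N by rewrite qv_le // ltn_ord leqnn.
by rewrite qv_end; apply: leq_trans; rewrite qvS // ltn_add2l.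
Qed.

(* The blocks start at the sites q_j, hence read 0(10)^n: they are the blocks of
   the word rotated by one letter, which makes [q_0 = 0] the first site. *)
Definition site (j : 'I_m) (k : 'I_(block_size j)) : 'I_L :=
  Ordinal (site_subproof k).

Lemma site_bij : bijective (fun u : {j & 'I_(block_size j)} => site (tagged u)).
Proof.
have surj (i : 'I_L) : exists u : {j & 'I_(block_size j)}, site (tagged u) == i.
  have [j jm /andP[ji ij]] := qv_bracket q0 (ltn_ord i).
  have kj : (i - qv q j < block_size (Ordinal jm))%N.
    by rewrite qvS // in ij; rewrite /block_size /=; lia.
  exists (Tagged (fun j => 'I_(block_size j)) (Ordinal kj)).
  by apply/eqP/val_inj; rewrite /= subnKC.
have inj : injective (fun u : {j & 'I_(block_size j)} => site (tagged u)).
  have main (j j' : 'I_m) (k : 'I_(block_size j)) (k' : 'I_(block_size j')) :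
      (qv q j + k = qv q j' + k')%N -> ~~ (j < j')%N.
    move=> kk; apply/negP => jj.
    have : (qv q j.+1 <= qv q j')%N by rewrite qv_le // jj ltnW.
    have kl : (k < (gap_index q j).*2.+1)%N := ltn_ord k.
    by rewrite qvS //; lia.
  move=> [j k] [j' k'] /= /(congr1 val) /= kk.
  have jj : j = j'.
    apply/val_inj/eqP; have := main _ _ _ _ kk; have := main _ _ _ _ (esym kk).
    by rewrite eqn_leq -!leqNgt => -> ->.
  case: j' / jj k' kk => k' /addnI kk.
  by congr existT; apply: val_inj.
exists (fun i => xchoose (surj i)) => [u|i]; last exact/eqP/(xchooseP (surj i)).
exact/inj/eqP/(xchooseP (surj _)).
Qed.

Lemma ord_pred_site (j : 'I_m) (k : 'I_(block_size j)) : val k != 0%N ->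
  ord_pred (site k) = site (ord_pred k).
Proof.
move=> k0; apply/val_inj; rewrite val_ord_pred [val (site _)]/=; last first.
  by rewrite addn_eq0 negb_and k0 orbT.
have -> : val (site (ord_pred k)) = (qv q j + val (ord_pred k))%N by [].
by rewrite val_ord_pred // -!subn1 addnBA // lt0n.
Qed.

Lemma ord_pred_site0 (j : 'I_m) (k : 'I_(block_size j)) : val k = 0%N ->
  exists j' : 'I_m, ord_pred (site k) = @site j' ord_max.
Proof.
move=> k0; have [j0|j0] := eqVneq (val j) 0%N.
  (* The predecessor of site 0 is site L - 1, the end of the last block. *)
  have m1 : (m.-1 < m)%N by lia.
  exists (Ordinal m1); apply/val_inj; rewrite /= k0 j0 q0.
  have := qvS m1; rewrite prednK; last by lia.
  by rewrite qv_end !add0n => E; rewrite modn_small; lia.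
have j1 : (j.-1 < m)%N by have := ltn_ord j; lia.
exists (Ordinal j1); apply/val_inj.
have E := qvS j1; rewrite prednK ?lt0n // in E.
by rewrite val_ord_pred /= k0 addn0 E; lia.
Qed.

Lemma occ_config_of (j : 'I_m) (k : 'I_(block_size j)) :
  occ (config_of q) (site k) = odd k.
Proof.
(* The first site of a block carries the final 0 of the preceding block of the word. *)
rewrite occ_mk; have [k0|k0] := eqVneq (val k) 0%N.
  have [j' ->] := ord_pred_site0 k0.
  by rewrite [LHS]nth_word //= odd_double ltnn k0.
have kE : nat_of_ord k = (ord_pred k).+1.
  by rewrite [nat_of_ord (ord_pred k)]val_ord_pred // prednK // lt0n.
have kl : (ord_pred k < (gap_index q j).*2)%N by rewrite -ltnS -kE; exact: ltn_ord k.
rewrite ord_pred_site // kE; apply: etrans (nth_word (ltn_ord j) (ltnW kl)) _.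
by rewrite kl andbT.
Qed.

Lemma config_of_frozen : frozen (config_of q).
Proof.
apply/forallP => i; have [g _ gK] := site_bij.
rewrite /pair2 -[i]gK; case: (g i) => j k /=.
have [k0|k0] := eqVneq (val k) 0%N.
  by rewrite [X in _ && X]occ_config_of k0 andbF.
have kE : nat_of_ord k = (ord_pred k).+1.
  by rewrite [nat_of_ord (ord_pred k)]val_ord_pred // prednK // lt0n.
by rewrite ord_pred_site // !occ_config_of [in X in _ && X]kE /= andbN.
Qed.

Lemma config_of_vacant2 (j : 'I_m) (k : 'I_(block_size j)) : val k = 0%N ->
  vacant2 (config_of q) (site k).
Proof.
move=> k0; have [j' E] := ord_pred_site0 k0.
by rewrite /vacant2 E !occ_config_of /= odd_double k0.
Qed.

Lemma restr_config_of j :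
  restr site j (config_of q) = zigzag (gap_index q j).
Proof. by apply/config_eqP => k; rewrite [LHS]occ_mk [RHS]occ_mk occ_config_of. Qed.

Lemma n_particles_config_of : n_particles (config_of q) = N.
Proof.
rewrite (n_particles_restr site_bij).
under eq_bigr do rewrite restr_config_of n_particles_zigzag.
(* At [j = m] this reads L = 2 (n_0 + ... + n_(m-1)) + m with m = L - 2N, so the n_i add up to N. *)
have H j : (j <= m)%N -> (qv q j = 2 * (\sum_(i < j) gap_index q i) + j)%N.
  elim: j => [|j IHj] jm; first by rewrite q0 big_ord0.
  rewrite qvS // big_ord_recr /= IHj 1?ltnW //.
  by move: (\sum_(i < j) _)%N => s; rewrite mulnDr -mul2n addnS addnAC addnS.
have := H m (leqnn m); rewrite qv_end; move: (\sum_(i < m) _)%N => s; lia.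
Qed.

End admissible.

End words.

Lemma card_sector L N : #|sector L N| = 'C(L, N).
Proof.
rewrite -[in RHS](card_ord L) -card_draws -!sum1_card.
pose f (A : {set 'I_L}) : config L := mk_config (fun i => i \in A).
rewrite (reindex f) /=; last first.
  exists (fun x : config L => finset (fun i => occ x i)) => [A|x] _.
    by apply/setP => i; rewrite inE occ_mk.
  by apply/config_eqP => i; rewrite occ_mk inE.
apply: eq_bigl => A; rewrite !inE /n_particles -sum1_card [in RHS]big_mkcond /=.
by congr (_ == _); apply: eq_bigr => i _; rewrite occ_mk; case: (i \in A).
Qed.

(** Two neighbours of a frozen configuration are equal only in a pair of holes, so occupation
    alternates from one such pair to the next. *)
Lemma occ_run L (x : config L) (v k : nat) : frozen x ->
    (forall i : 'I_L, val i = v -> vacant2 x i) ->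
    (forall i : 'I_L, (v < i <= v + k)%N -> ~~ vacant2 x i) ->
  forall i : 'I_L, val i = (v + k)%N -> occ x i = odd k.
Proof.
move=> fx xv; elim: k => [|k IHk] nv i iE.
  by rewrite addn0 in iE; have /andP[_ /negbTE] := xv i iE.
have i0 : val i != 0%N by rewrite iE addnS.
have iP : val (ord_pred i) = (v + k)%N by rewrite val_ord_pred // iE addnS.
have {}IHk : occ x (ord_pred i) = odd k.
  by apply: IHk iP => j /andP[vj jk]; rewrite nv // vj addnS leqW.
have := nv i; rewrite [nat_of_ord i]iE addnS ltnS leq_addr leqnn => /(_ isT).
have /forallP/(_ i) := fx; rewrite /pair2 /vacant2 IHk /=.
by case: odd; case: occ.
Qed.

(** * Reading an admissible tuple off a frozen configuration *)

Section parsing.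
Variables L N : nat.
Hypothesis hN : (2 * N < L)%N.
Local Notation m := (L - 2 * N)%N.

(** The tuple lists in increasing order the sites that are empty and preceded by an empty site;
    there are L - 2N of them. Each gap is odd because its alternating run begins and ends with a
    hole. *)
Lemma config_of_surj (x : config L) (o : 'I_L) : val o = 0%N ->
    frozen x -> n_particles x = N -> vacant2 x o ->
  exists2 q : m.-tuple 'I_L, admissible q & config_of q = x.
Proof.
move=> o0 fx xN xo; pose s := enum (vacant2 x).
have ss : size s == m.
  rewrite -cardE -sum1_card big_mkcond /=; apply/eqP.
  have := sum_vacant2_frozen fx; rewrite xN.
  rewrite (eq_bigr (fun i => vacant2 x i : nat)); first by lia.
  by move=> i _; rewrite -[i \in _]/(vacant2 x i); case: vacant2.
pose q : m.-tuple 'I_L := Tuple ss.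
have qs : sorted ltn (map val q).
  apply: (subseq_sorted ltn_trans _ (iota_ltn_sorted 0 L)).
  rewrite -val_enum_ord; apply: map_subseq.
  by rewrite [X in subseq _ X]enumT; exact: filter_subseq.
have mem_q (i : 'I_L) : vacant2 x i -> exists2 j, (j < m)%N & qv q j = i.
  move=> xi; have iq : i \in s by rewrite mem_enum.
  exists (index i s); first by rewrite -(eqP ss) index_mem.
  by rewrite /qv (nth_map o) ?index_mem // nth_index.
have q_vac (i : 'I_L) j : (j < m)%N -> val i = qv q j -> vacant2 x i.
  move=> jm; rewrite (qv_nth q jm) => /val_inj ->.
  by have := mem_tnth (Ordinal jm) q; rewrite mem_enum.
have q0 : qv q 0 = 0%N.
  have [[|j] jm jE] := mem_q o xo; first by rewrite jE.
  have : (qv q 0 < qv q j.+1)%N by apply: qv_lt => //; exact: ltnW.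
  by rewrite jE [nat_of_ord o]o0.
have q_gap (i : 'I_L) j : (j < m)%N -> (qv q j < i < qv q j.+1)%N -> ~~ vacant2 x i.
  move=> jm /andP[ji ij]; apply/negP => /mem_q[j' j'm j'E].
  rewrite -j'E in ji ij; have [jj|jj] := leqP j' j.
    by move: ji; rewrite ltnNge qv_le // jj ltnW.
  by move: ij; rewrite ltnNge qv_le // jj ltnW.
have q_occ (i : 'I_L) j k : (j < m)%N -> (qv q j + k < qv q j.+1)%N ->
    val i = (qv q j + k)%N -> occ x i = odd k.
  move=> jm kj; apply: (occ_run fx) => [i' i'E|i' /andP[ji ik]].
    exact: q_vac jm i'E.
  by apply: (q_gap _ _ jm); rewrite ji (leq_ltn_trans ik kj).
have qa : admissible q.
  apply/and3P; split => //; first by rewrite q0.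
  apply/forallP => j; have jm := ltn_ord j.
  have lt : (qv q j < qv q j.+1)%N by rewrite qv_lt // leqnn.
  (* The site at offset [k] is the last one before the next pair of holes is completed; it is empty,
     so [k] is even. *)
  pose k := (qv q j.+1 - qv q j).-1.
  have kL : (qv q j + k < L)%N.
    have : (qv q j.+1 <= qv q m)%N by rewrite qv_le // jm leqnn.
    by rewrite qv_end; lia.
  have kE : occ x (Ordinal kL) = odd k.
    by apply: (q_occ _ j) => //; lia.
  suff : ~~ odd k by rewrite /k; lia.
  rewrite -kE.
  have [i iE xi] : exists2 i : 'I_L, ord_pred i = Ordinal kL & vacant2 x i.
    exists (ordS (Ordinal kL)); rewrite ?ordSK //.
    have kS : (qv q j + k).+1 = qv q j.+1 by lia.
    have [jm1|jm1] := ltnP j.+1 m.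
      apply: (q_vac _ j.+1 jm1); rewrite /= kS modn_small //.
      by rewrite (qv_nth q jm1).
    (* For the last gap [qv] takes its default value L, and the next site modulo L is [o]. *)
    suff -> : ordS (Ordinal kL) = o by [].
    apply/val_inj; rewrite /= kS o0.
    have -> : j.+1 = m by apply/eqP; rewrite eqn_leq jm1 jm.
    by rewrite qv_end modnn.
  by have /andP[] := xi; rewrite iE.
exists q => //; apply/config_eqP => i.
have [j jm /andP[ji ij]] := qv_bracket q0 (ltn_ord i).
have kj : (i - qv q j < block_size q (Ordinal jm))%N.
  by rewrite (qvS hN qa) // in ij; rewrite /block_size /=; lia.
rewrite (_ : i = site hN qa (Ordinal kj)); last by apply/val_inj; rewrite /= subnKC.
by rewrite occ_config_of; apply/esym/(q_occ _ j) => //=; rewrite subnKC.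
Qed.

End parsing.

(** * Masses of frozen configurations and Catalan numbers *)

Section masses.
Variables (R : realType) (p : R).
Hypothesis hp : 0 <= p <= 1.

(** There is exactly 2n + 1 - 2n = 1 pair of holes, so the run that starts at site 0 alternates all
    the way round. *)
Lemma zigzag_config (n : nat) (z : config n.*2.+1) :
  frozen z -> n_particles z = n -> vacant2 z ord0 -> z = zigzag n.
Proof.
move=> fz zn z0; apply/config_eqP => i; rewrite occ_mk.
apply: (@occ_run _ z 0 i fz) => // j.
  by move=> j0; rewrite (_ : j = ord0) //; exact: val_inj.
move=> /andP[j0 _]; apply/negP => zj.
have := sum_vacant2_frozen fz; rewrite zn (bigD1 ord0) //= z0 (bigD1 j) //=.
  by rewrite zj; lia.
by rewrite -lt0n.
Qed.

Lemma zigzag_frozen n : frozen (zigzag n).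
Proof.
apply/forallP => i; rewrite /pair2 !occ_mk.
have [->|i0] := eqVneq (nat_of_ord i) 0%N; first by rewrite andbF.
have iE : nat_of_ord i = (ord_pred i).+1.
  by rewrite [nat_of_ord (ord_pred i)]val_ord_pred // prednK // lt0n.
by rewrite [in X in _ && X]iE /= andbN.
Qed.

Lemma zigzag_vacant2 n : vacant2 (zigzag n) ord0.
Proof. by rewrite /vacant2 !occ_mk /= modn_small ?add0n //= odd_double. Qed.

Lemma mass_zigzag n : mass p (zigzag n) = catalan R n.
Proof.
have nn : (2 * n < n.*2.+1)%N by rewrite mul2n.
have := sum_mass_vacant2 hp ord0 nn.
rewrite (big_pred1 (zigzag n)) => [|z]; last first.
  apply/idP/eqP => [/and3P[? /eqP ? ?]|->]; first exact: zigzag_config.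
  by rewrite zigzag_frozen n_particles_zigzag eqxx zigzag_vacant2.
rewrite card_sector mul2n subSn // subnn mul1r => E.
apply: (mulfI (_ : n.*2.+1%:R != 0 :> R)); first by rewrite pnatr_eq0.
rewrite E /catalan mulrCA mul2n -natrM.
(* What remains is (n + 1) C(2n + 1, n) = (2n + 1) C(2n, n). *)
apply: (mulfI (_ : n.+1%:R != 0 :> R)); first by rewrite pnatr_eq0.
rewrite mulVKf ?pnatr_eq0 // -natrM; congr (_%:R).
rewrite [RHS](mul_bin_diag n.*2.+1 n) -bin_sub; last by rewrite -addnn leqW // leq_addr.
by rewrite -addnn subSn ?leq_addr // addnK.
Qed.

Lemma mass_config_of L N (q : (L - 2 * N).-tuple 'I_L) :
    (2 * N < L)%N -> admissible q ->
  mass p (config_of q) = \prod_(i < L - 2 * N) catalan R (gap_index q i).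
Proof.
move=> hN qa.
rewrite (mass_blocks hp _ (site_bij hN qa) (ord_pred_site hN qa)) //.
- by apply: eq_bigr => j _; rewrite restr_config_of mass_zigzag.
- exact: config_of_frozen.
- by rewrite n_particles_config_of.
- by move=> j k k0; exact: config_of_vacant2.
Qed.

End masses.

(** * The semigroup of a finite chain *)

Section semigroup.
Variables (R : realType) (L : nat) (q : config L -> config L -> R).
Implicit Types (f w : config L -> R) (x y : config L) (t : R).

Local Notation G := (generator q).

(** The generator is a bounded operator on a finite-dimensional space; the geometric bound lets the
    exponential series be compared with a scalar one. *)
Lemma iter_generator_bound f : exists C M : R, [/\ 0 <= C, 0 <= M &
  forall k x, `|iter k G f x| <= M * C ^+ k].
Proof.
have Q0 : 0 <= \sum_x \sum_y `|q x y| by do 2 (apply: sumr_ge0 => ? _).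
exists (2 * \sum_x \sum_y `|q x y|), (\sum_x `|f x|); split.
- by rewrite mulr_ge0.
- by apply: sumr_ge0.
elim=> [|k IHk] x.
  by rewrite expr0 mulr1 (bigD1 x) //= lerDl sumr_ge0.
rewrite iterS /generator (le_trans (ler_norm_sum _ _ _)) //.
move: IHk; set C := 2 * _; set B := _ * C ^+ k => IHk.
have B0 : 0 <= B := le_trans (normr_ge0 _) (IHk x).
apply: (@le_trans _ _ (\sum_y `|q x y| * (2 * B))).
  apply: ler_sum => y _; rewrite normrM ler_wpM2l // (le_trans (ler_normB _ _)) //.
  by rewrite mulr_natl mulr2n lerD.
have -> : (\sum_x `|f x|) * C ^+ k.+1 = C * B by rewrite exprS mulrCA.
rewrite -mulr_suml mulrA ler_wpM2r // mulrC ler_wpM2l //.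
by rewrite [leRHS](bigD1 x) //= lerDl; apply: sumr_ge0 => ? _; apply: sumr_ge0.
Qed.

Lemma iter_generator_sum (I : Type) (r : seq I) (a : I -> R)
    (F : I -> config L -> R) k x :
  iter k G (fun y => \sum_(i <- r) a i * F i y) x =
  \sum_(i <- r) a i * iter k G (F i) x.
Proof.
elim: k x => [//|k IHk] x; rewrite iterS /generator.
under eq_bigr do rewrite !IHk -sumrB mulr_sumr.
rewrite exchange_big /=; apply: eq_bigr => i _; rewrite mulr_sumr.
by apply: eq_bigr => y _; rewrite /generator; ring.
Qed.

Definition exp_coef w f : R^nat := fun k => (\sum_x w x * iter k G f x) / k`!%:R.

(* The expectation of [f] at time [t] for the chain started from the weights [w]. *)
Definition expect w f t : R := limn (pseries (exp_coef w f) t).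

Lemma is_cvg_exp_coef w f t : cvgn (pseries (exp_coef w f) t).
Proof.
have [C [M [C0 M0 CM]]] := iter_generator_bound f.
pose K := (\sum_x `|w x|) * M.
have K0 : 0 <= K by rewrite mulr_ge0 // sumr_ge0.
apply: normed_cvg; apply: (@series_le_cvg _ _ (fun k => K * exp_coeff (C * `|t|) k)).
- by move=> n; exact: normr_ge0.
- by move=> n; rewrite mulr_ge0 // exp_coeff_ge0 // mulr_ge0.
- move=> n; rewrite /exp_coef /exp_coeff /= !normrM normfV normrX.
  rewrite (ger0_norm (ler0n _ _)) exprMn mulrAC !mulrA ler_wpM2r ?invr_ge0 //.
  rewrite ler_wpM2r ?exprn_ge0 // (le_trans (ler_norm_sum _ _ _)) //.
  rewrite -mulrA mulr_suml; apply: ler_sum => x _; rewrite normrM ler_wpM2l //.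
- by apply: is_cvg_seriesZ; exact: is_cvg_series_exp_coeff.
Qed.

Lemma pseries_diffs_exp_coef w f : pseries_diffs (exp_coef w f) = exp_coef w (G f).
Proof.
apply/funext => k; rewrite /pseries_diffs /exp_coef.
under eq_bigr do rewrite iterSr.
rewrite factS natrM invfM mulrCA mulVKf ?pnatr_eq0 //.
Qed.

(** Differentiating the exponential series term by term shifts its coefficients, which amounts to
    replacing [f] by [G f]. *)
Lemma is_derive_expect w f t : is_derive t 1 (expect w f) (expect w (G f) t).
Proof.
rewrite /expect -pseries_diffs_exp_coef.
apply: (@pseries_snd_diffs _ _ (`|t| + 1)).
- exact: is_cvg_exp_coef.
- by rewrite pseries_diffs_exp_coef; exact: is_cvg_exp_coef.
- by rewrite !pseries_diffs_exp_coef; exact: is_cvg_exp_coef.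
- by rewrite [ltRHS]ger0_norm ?addr_ge0 // ltrDl.
Qed.

(** Only the constant term of the series survives. Restricting to [w x != 0] covers a point mass at
    a frozen configuration, with [f] arbitrary elsewhere. *)
Lemma expect_const w f t :
  (forall k x, w x != 0 -> iter k.+1 G f x = 0) -> expect w f t = \sum_x w x * f x.
Proof.
move=> f0; apply: cvg_lim => //; apply: cvg_near_cst; near=> n.
have n0 : (0 < n)%N by near: n; exists 1%N.
rewrite /pseries /series /= big_ltn // /exp_coef /= expr0 fact0 invr1 !mulr1.
rewrite [X in _ + X]big_nat_cond [X in _ + X]big1 ?addr0 // => -[|k] /andP[/andP[// _ _] _].
rewrite big1 ?mul0r // => x _; have [->|/f0 ->] := eqVneq (w x) 0.
  by rewrite mul0r.
by rewrite mulr0.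
Unshelve. all: by end_near. Qed.

Lemma expectE w f t : expect w f t =
  \sum_y (\sum_x w x * transition q t x y) * f y.
Proof.
have tc x y : cvgn (series (fun k => t ^+ k / k`!%:R *
    iter k G (fun z => (z == y)%:R) x)).
  rewrite (_ : (fun k => _) = fun k =>
      exp_coef (fun z => (z == x)%:R) (fun z => (z == y)%:R) k * t ^+ k).
    exact: is_cvg_exp_coef.
  apply/funext => k.
  rewrite /exp_coef (bigD1 x) //= big1 => [|z /negbTE ->]; last by rewrite mul0r.
  by rewrite eqxx mul1r addr0; ring.
apply: cvg_lim => //.
have -> : pseries (exp_coef w f) t = fun n => \sum_y \sum_x f y * w x *
    series (fun k => t ^+ k / k`!%:R * iter k G (fun z => (z == y)%:R) x) n.
  apply/funext => n; rewrite /pseries /series /=.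
  have fE : f = fun z => \sum_y f y * (z == y)%:R.
    apply/funext => z; rewrite (bigD1 z) //= big1 => [|y yz].
      by rewrite eqxx mulr1 addr0.
    by rewrite eq_sym (negbTE yz) mulr0.
  transitivity (\sum_(0 <= k < n) \sum_y \sum_x f y * w x *
      (t ^+ k / k`!%:R * iter k G (fun z => (z == y)%:R) x)).
    apply: eq_bigr => k _; rewrite /exp_coef {1}fE exchange_big /= !mulr_suml.
    apply: eq_bigr => x _; rewrite iter_generator_sum mulr_sumr !mulr_suml.
    by apply: eq_bigr => y _; ring.
  rewrite exchange_big; apply: eq_bigr => y _.
  by rewrite exchange_big; apply: eq_bigr => x _; rewrite mulr_sumr.
under eq_bigr do rewrite mulrC mulr_sumr.
apply: (cvg_big (op := +%R)) => [|y _]; first exact: add_continuous.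
apply: (cvg_big (op := +%R)) => [|x _]; first exact: add_continuous.
rewrite mulrA; apply: cvgM; first exact: cvg_cst.
exact: tc.
Qed.

End semigroup.

(** * Almost sure absorption *)

Lemma measurable_config d (Omega : measurableType d) (R : realType)
    (P : probability Omega R) L (X : {RV P >-> config L}) (A : set (config L)) :
  measurable (X @^-1` A).
Proof. exact: measurable_funPTI. Qed.

Lemma measure_partition d (Omega : measurableType d) (R : realType)
    (P : {measure set Omega -> \bar R}) L (f : Omega -> config L) (B : set Omega) :
    measurable B -> (forall a, measurable (f @^-1` [set a])) ->
  P B = (\sum_(a : config L) P (B `&` f @^-1` [set a]))%E.
Proof.
move=> mB mf; have mBf a : measurable (B `&` f @^-1` [set a]) by exact: measurableI.
pose U (s : seq (config L)) := [set w | B w /\ f w \in s].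
suff H (s : seq (config L)) : uniq s ->
    measurable (U s) /\ P (U s) = (\sum_(a <- s) P (B `&` f @^-1` [set a]))%E.
  have [_] := H _ (index_enum_uniq (config L)); rewrite /U.
  by congr (P _ = _); apply/seteqP; split => w /=; rewrite mem_index_enum => // -[].
elim: s => [_|a s IHs /= /andP[as_ us]].
  rewrite big_nil (_ : U [::] = set0) ?measure0 //.
  by apply/seteqP; split => w // [].
have [mU PU] := IHs us.
have UE : U (a :: s) = (B `&` f @^-1` [set a]) `|` U s.
  apply/seteqP; split => w /=.
    by move=> [Bw]; rewrite inE => /orP[/eqP|]; [left|right].
  by case=> [[Bw /= fa]|[Bw ws]]; split => //; rewrite inE ?ws ?orbT ?fa ?eqxx.
rewrite big_cons -PU UE; split; first exact: measurableU.
rewrite measureU //; apply/seteqP; split => w // [[_ /= fa] [_ fs]].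
by move: as_; rewrite -fa fs.
Qed.

Lemma card_sector_neq0 (R : realType) L N : (2 * N < L)%N ->
  #|sector L N|%:R != 0 :> R.
Proof. by move=> hN; rewrite card_sector pnatr_eq0 -lt0n bin_gt0; lia. Qed.

Section fasep_law.
Variables (R : realType) (L N : nat) (p : R).
Hypotheses (hN : (2 * N < L)%N) (hp : 0 <= p <= 1).
Variables (d : measure_display) (Omega : measurableType d)
  (P : probability Omega R) (eta : R -> {RV P >-> config L}).
Hypothesis heta : is_fasep p N eta.
Implicit Types (s t : R) (a b x y z : config L).

Local Notation q := (@fasep_rate R L p).
Local Notation init := (@uniform_law R L N).

Definition law t y : R := \sum_x init x * transition q t x y.

Lemma lawE t y : 0 <= t -> P (eta t @^-1` [set y]) = (law t y)%:E.
Proof.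
move=> t0; rewrite (measure_partition _ (measurable_config _ _)
  (fun a => measurable_config (eta 0) [set a])) /law -sumEFin.
apply: eq_bigr => x _.
have := @finite_dim_laws _ _ _ _ _ _ _ _ heta x [:: (t, y)]; rewrite /= t0 => /(_ isT).
rewrite subr0 mulr1 => <-; congr (P _); apply/seteqP; split => w /=.
  by move=> [ty xw]; split => // c; rewrite inE => /eqP ->.
by move=> [xw H]; split => //; have := H (t, y); rewrite inE eqxx => /(_ isT).
Qed.

Lemma law_ge0 t y : 0 <= t -> 0 <= law t y.
Proof. by move=> t0; rewrite -lee_fin -lawE // measure_ge0. Qed.

Lemma expect_law f t : expect q init f t = \sum_y law t y * f y.
Proof. exact: expectE. Qed.

Lemma expect_harmonic (w f : config L -> R) t :
  (forall x, generator q f x = 0) -> expect q w f t = \sum_x w x * f x.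
Proof.
move=> f0; apply: expect_const => k x _; rewrite iterSr.
have -> : generator q f = fun=> 0 by apply/funext.
elim: k x => //= k IHk x; rewrite /generator big1 // => y _.
by rewrite !IHk subrr mulr0.
Qed.

Lemma transition_frozen t a b : frozen a -> transition q t a b = (a == b)%:R.
Proof.
move=> fa; have := @expectE R L q (fun x => (x == a)%:R) (fun x => (x == b)%:R) t.
rewrite expect_const; last first.
  move=> k x; have [->|] := eqVneq x a; last by rewrite eqxx.
  by rewrite iterS generator_frozen.
have sumd c (F : config L -> R) : \sum_x (x == c)%:R * F x = F c.
  rewrite (bigD1 c) //= eqxx mul1r big1 ?addr0 // => x /negbTE ->.
  by rewrite mul0r.
by rewrite sumd => ->; under eq_bigr do rewrite mulrC; rewrite !sumd.
Qed.

Lemma frozen_stays s t a b : 0 <= s <= t -> frozen a -> b != a ->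
  P (eta s @^-1` [set a] `&` eta t @^-1` [set b]) = 0%E.
Proof.
move=> /andP[s0 st] fa ba.
rewrite (measure_partition _ _ (fun a => measurable_config (eta 0) [set a])); last first.
  by apply: measurableI; exact: measurable_config.
rewrite big1 // => x _.
have := @finite_dim_laws _ _ _ _ _ _ _ _ heta x [:: (s, a); (t, b)].
rewrite /= s0 st => /(_ isT).
rewrite (transition_frozen _ _ fa) eq_sym (negbTE ba) mul0r !mulr0 => E.
apply: etrans E; congr (P _); apply/seteqP; split => w /=.
  by move=> [[sa tb] xw]; split => // c; rewrite !inE => /orP[] /eqP ->.
move=> [xw H]; split => //; have := H (t, b); have := H (s, a).
by rewrite !inE !eqxx orbT => /(_ isT) ? /(_ isT).
Qed.

Lemma frozen_stays_prob s t a : 0 <= s <= t -> frozen a ->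
  P (eta s @^-1` [set a] `&` eta t @^-1` [set a]) = (law s a)%:E.
Proof.
move=> st fa; have /andP[s0 _] := st; rewrite -lawE //.
rewrite (measure_partition _ (measurable_config (eta s) [set a])
  (fun a => measurable_config (eta t) [set a])).
rewrite (bigD1 a) //= big1 ?adde0 // => b ba; exact: frozen_stays.
Qed.

Lemma law_frozen_le s t a : 0 <= s <= t -> frozen a -> law s a <= law t a.
Proof.
move=> st fa; rewrite -lee_fin -(frozen_stays_prob st fa) -lawE; last first.
  by have /andP[s0 s_le_t] := st; exact: le_trans s_le_t.
by apply: le_measure; rewrite ?inE //; [apply: measurableI|]; exact: measurable_config.
Qed.

Lemma sum_init : \sum_x init x = 1.
Proof.
rewrite /uniform_law -mulr_suml -natr_sum.
rewrite (_ : (\sum_x _)%N = #|sector L N|) ?divff ?card_sector_neq0 //.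
by rewrite -sum1_card [RHS]big_mkcond; apply: eq_bigr => x _; case: (x \in _).
Qed.

Lemma init_sum f : (forall x, n_particles x != N -> f x = 0) ->
  \sum_x init x * f x = (\sum_x f x) / #|sector L N|%:R.
Proof.
move=> f0; rewrite mulr_suml; apply: eq_bigr => x _.
rewrite /uniform_law inE; case: eqVneq => [_|/f0 ->]; last by rewrite mulr0 mul0r.
by rewrite mul1r mulrC.
Qed.

Lemma sum_law t : \sum_y law t y = 1.
Proof.
have := expect_law (fun=> 1) t; rewrite expect_harmonic; last first.
  by move=> x; rewrite /generator big1 // => y _; rewrite subrr mulr0.
under eq_bigr do rewrite mulr1.
by rewrite sum_init => {1}->; apply: eq_bigr => y _; rewrite mulr1.
Qed.

(** The indicator of the other sectors is harmonic, so its expectation keeps its initial value 0,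
    and all terms of that expectation are nonnegative. *)
Lemma law_sector t y : 0 <= t -> n_particles y != N -> law t y = 0.
Proof.
move=> t0 yN; have := expect_law (fun x => (n_particles x != N)%:R) t.
rewrite expect_harmonic => [|x]; last first.
  rewrite generatorE big1 // => i _.
  case: (boolP (facil x _ _ _)) => [/n_particles_hop ->|_];
  case: (boolP (facil x _ _ _)) => [/n_particles_hop ->|_];
  by rewrite ?subrr !(mulr0, mul0r) addr0.
rewrite big1 => [|x _]; last first.
  by rewrite /uniform_law inE; case: eqVneq => _; rewrite !(mulr0, mul0r).
move=> /esym/eqP; rewrite psumr_eq0 => [/allP/(_ y)|x _]; last first.
  by rewrite mulr_ge0 // law_ge0.
by rewrite mem_index_enum yN mulr1 => /(_ isT)/eqP.
Qed.

Definition active t := \sum_(y | ~~ frozen y) law t y.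

Lemma active_le s t : 0 <= s <= t -> active t <= active s.
Proof.
move=> st; have E u : active u = 1 - \sum_(y | frozen y) law u y.
  by rewrite -(sum_law u) (bigID (fun y => frozen y)) /= addrAC subrr add0r.
by rewrite !E lerB //; apply: ler_sum => y; exact: law_frozen_le.
Qed.

(* A function [V] with [generator V = -1] off the frozen configurations is a
   Lyapunov function: [E V] decreases at speed at least [active t] up to time [t]. *)
Lemma active_decay : exists K : R, forall t, 0 < t -> t * active t <= K.
Proof.
have [V [V1 V2]] := dirichlet_exists hp (fun x => - (transient x)%:R : R).
have V0 x : n_particles x = N -> 0 <= V x.
  move=> xN; rewrite -oppr_le0 -mulN1r.
  apply: (maximum_principle hp (@hop_closed_n L (pred1 N)) (f := fun y => -1 * V y)
    _ _ _ (x := x)) => [y /eqP -> //|y /eqP yN fy|y /eqP yN fy|].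
  - by rewrite generatorZ V1 ?mulN1r ?opprK // /transient fy yN.
  - by rewrite V2 /transient fy // oppr0 mulr0.
  - by rewrite /= xN.
(* The initial expectation of [V] bounds the total decrease, as [V] is nonnegative on the sector. *)
exists (expect q init V 0) => t t0.
have E s : 0 <= s -> expect q init (generator q V) s = - active s.
  move=> s0; rewrite expect_law /active [in RHS]big_mkcond -sumrN.
  apply: eq_bigr => y _; have [yN|yN] := eqVneq (n_particles y) N; last first.
    by rewrite law_sector // mul0r; case: ifP; rewrite oppr0.
  have [fy|fy] := boolP (frozen y); first by rewrite generator_frozen // mulr0 oppr0.
  by rewrite V1 /transient fy yN hN // mulrN1.
have dV s : is_derive s 1 (expect q init V) (expect q init (generator q V) s).
  exact: is_derive_expect.
have cV : {within `[0, t], continuous (expect q init V)}.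
  by apply: derivable_within_continuous => s _; have := dV s => -[].
(* The decrease of the expectation over [0, t] is [t * active s] for some [s] before [t], and
   [active] is nonincreasing. *)
have [s] := MVT t0 (fun s _ => dV s) cV.
rewrite in_itv /= => /andP[s0 st]; rewrite E ?(ltW s0) // subr0 => VE.
have Vt : 0 <= expect q init V t.
  rewrite expect_law; apply: sumr_ge0 => y _.
  have [yN|yN] := eqVneq (n_particles y) N; last by rewrite law_sector ?mul0r // ltW.
  by rewrite mulr_ge0 ?law_ge0 ?V0 // ltW.
have : active t <= active s by apply: active_le; rewrite !ltW.
by move: VE; rewrite mulNr mulrC; nra.
Qed.

Lemma law_limit z : frozen z -> n_particles z = N ->
  exists K : R, forall t, 0 < t -> mass p z / #|sector L N|%:R <= law t z + K / t.
Proof.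
move=> fz zN; have [K KP] := active_decay.
pose B := \sum_y `|hit p z y|; exists (B * K) => t t0.
have := expect_law (hit p z) t; rewrite expect_harmonic; last first.
  by move=> x; rewrite hit_harmonic // zN.
rewrite init_sum => [->|x]; last first.
  by move=> xN; apply/eqP; apply: contraNT xN => /(hit_neq0_n hp) ->; apply/eqP.
rewrite (bigID (fun y => frozen y)) /=; apply: lerD.
  rewrite (bigD1 z) //= hit_frozen // eqxx mulr1 big1 ?addr0 // => y /andP[fy yz].
  by rewrite hit_frozen // (negbTE yz) mulr0.
apply: (@le_trans _ _ (B * active t)); last first.
  rewrite -mulrA ler_wpM2l ?sumr_ge0 // ler_pdivlMr // mulrC; exact: KP.
rewrite mulr_sumr; apply: ler_sum => y _; rewrite mulrC.
rewrite ler_wpM2r ?law_ge0 ?(ltW t0) // (le_trans (ler_norm _)) //.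
by rewrite /B (bigD1 y) //= lerDl sumr_ge0.
Qed.

End fasep_law.

(** * The absorption law and its relation to [nu] *)

Section absorption_law.
Variables (R : realType) (L N : nat) (p : R).
Hypotheses (hN : (2 * N < L)%N) (hp : 0 <= p <= 1).
Implicit Types (x y z : config L).

Definition absorption x : R :=
  if frozen x && (n_particles x == N) then mass p x / #|sector L N|%:R else 0.

Lemma sum_absorption : \sum_x absorption x = 1.
Proof.
rewrite /absorption -big_mkcond /= -mulr_suml sum_mass //.
by rewrite divff // card_sector_neq0.
Qed.

Lemma absorption_tau x : absorption (tau x) = absorption x.
Proof. by rewrite /absorption frozen_tau n_particles_tau mass_tau. Qed.

(** The factor L / (L - 2N) is that of conditioning on a pair of holes at the sites L - 1 and 0, an
    event of probability (L - 2N) / L by [sum_mass_vacant2]. *)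
Lemma nu_weight_absorption (q : (L - 2 * N).-tuple 'I_L) : admissible q ->
  nu_weight R q = L%:R / (L - 2 * N)%:R * absorption (config_of q).
Proof.
move=> qa; rewrite /nu_weight /absorption config_of_frozen // n_particles_config_of //.
rewrite eqxx mass_config_of // card_sector invfM -!mulrA; congr (_ * _).
by rewrite mulrCA.
Qed.

Lemma sum_config_of (o : 'I_L) (F : config L -> R) : val o = 0%N ->
  \sum_(q : (L - 2 * N).-tuple 'I_L | admissible q) F (config_of q) =
  \sum_(x | [&& frozen x, n_particles x == N & vacant2 x o]) F x.
Proof.
move=> o0.
rewrite (partition_big (@config_of L N)
    (fun x => [&& frozen x, n_particles x == N & vacant2 x o])); last first.
  move=> q qa; rewrite config_of_frozen // n_particles_config_of // eqxx /=.
  have m0 : (0 < L - 2 * N)%N by rewrite subn_gt0.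
  have k0 : (0 < block_size q (Ordinal m0))%N by [].
  rewrite (_ : o = site hN qa (Ordinal k0)) ?config_of_vacant2 //.
  by apply/val_inj; rewrite /= o0 addn0; have /and3P[/eqP ->] := qa.
apply: eq_bigr => x /and3P[fx /eqP xN xo].
have [q qa qx] := config_of_surj hN o0 fx xN xo.
rewrite (big_pred1 q) ?qx // => r /=; apply/andP/eqP => [[ra /eqP rx]|-> //].
  by apply: config_of_inj => //; rewrite rx.
by rewrite qx.
Qed.

(** Rotation by [i] carries the pair of holes at site 0 to site [i]. Summing over [i] thus counts
    each frozen configuration once for each of its L - 2N pairs. *)
Lemma sum_rotations (g : config L -> R) :
  \sum_(i < L) \sum_(q : (L - 2 * N).-tuple 'I_L | admissible q)
     nu_weight R q * g (iter i (@tau L) (config_of q)) =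
  L%:R * \sum_x absorption x * g x.
Proof.
have L0 : (0 < L)%N by lia.
pose o := Ordinal L0; pose D : R := (L - 2 * N)%:R.
have D0 : D != 0 by rewrite pnatr_eq0 -lt0n subn_gt0.
pose S i := \sum_(x | [&& frozen x, n_particles x == N & vacant2 x i]) absorption x * g x.
have tau_iter (i : nat) : injective (iter i (@tau L)).
  by elim: i => [//|i IHi] x y /= /tau_inj/IHi.
have absorption_iter (i : nat) x : absorption (iter i (@tau L) x) = absorption x.
  by elim: i => //= i IHi; rewrite absorption_tau.
have S_iter (i : nat) : \sum_(q : (L - 2 * N).-tuple 'I_L | admissible q)
    nu_weight R q * g (iter i (@tau L) (config_of q)) = L%:R / D * S (iter i (@ordS L) o).
  transitivity (L%:R / D * \sum_(q : (L - 2 * N).-tuple 'I_L | admissible q)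
      absorption (config_of q) * g (iter i (@tau L) (config_of q))).
    by rewrite mulr_sumr; apply: eq_bigr => q qa; rewrite nu_weight_absorption // mulrA.
  rewrite (sum_config_of (fun x => absorption x * g (iter i (@tau L) x)) (o := o)) //.
  congr (_ * _); rewrite /S [RHS](reindex_inj (tau_iter i)); apply: eq_big => x.
    by elim: i => [//|i ->]; rewrite !iterS frozen_tau n_particles_tau vacant2_tau.
  by rewrite absorption_iter.
under eq_bigr do rewrite S_iter.
rewrite -mulr_sumr -mulrA; congr (_ * _); apply: (mulfI D0); rewrite mulVKf //.
transitivity (\sum_(i < L) S i).
  apply: eq_bigr => i _; congr (S _); apply/val_inj.
  by rewrite iter_ordS add0n modn_small.
rewrite /S; under eq_bigr do rewrite big_mkcond /=.
rewrite exchange_big /= mulr_sumr; apply: eq_bigr => x _.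
have [/andP[fx /eqP xN]|/negbTE xx] := boolP (frozen x && (n_particles x == N)).
  have -> : D = (\sum_i vacant2 x i)%N%:R.
    by rewrite /D -xN; congr (_%:R); have := sum_vacant2_frozen fx; lia.
  rewrite natr_sum mulr_suml; apply: eq_bigr => i _.
  by rewrite fx xN eqxx /=; case: vacant2; rewrite ?mul1r ?mul0r.
rewrite big1 => [|i _]; last by rewrite andbA xx.
by rewrite /absorption xx mul0r mulr0.
Qed.

End absorption_law.

(** * Existence and law of the limit *)

Section limit.
Variables (R : realType) (L N : nat) (p : R).
Hypotheses (hN : (2 * N < L)%N) (hp : 0 <= p <= 1).
Variables (d : measure_display) (Omega : measurableType d)
  (P : probability Omega R) (eta : R -> {RV P >-> config L}).
Hypothesis heta : is_fasep p N eta.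
Implicit Types (a b : config L) (w : Omega).

Definition conv_to a : set Omega := [set w | \forall t \near +oo, eta t w = a].

Lemma dense_seq : exists r : R^nat, forall x y : R, x < y -> exists k, x < r k < y.
Proof.
exists (fun k => if unpickle k is Some c then ratr (c : rat) else 0) => x y xy.
have [c] := rat_in_itvoo xy; rewrite in_itv /= => cxy.
by exists (pickle c); rewrite pickleK.
Qed.

Lemma near_right (t : R) w : 0 <= t ->
  exists2 e : R, 0 < e & forall s, t < s < t + e -> eta s w = eta t w.
Proof.
move=> t0; have /(_ [set eta t w]) := @right_continuous_paths _ _ _ _ _ _ _ _ heta w t t0.
move=> /(_ (discrete_set1 _))[e /= e0 He]; exists e => // s /andP[ts se].
apply: (He s _ ts); rewrite /= distrC ger0_norm ?subr_ge0 1?ltW //.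
by rewrite ltrBlDl.
Qed.

(** This expresses convergence through countably many times, hence its measurability: by
    right-continuity the value at [t] is also taken at some [r k] shortly after [t]. *)
Lemma conv_toE (r : R^nat) : (forall x y : R, x < y -> exists k, x < r k < y) ->
  forall a, conv_to a =
    \bigcup_n \bigcap_k [set w | n%:R <= r k -> eta (r k) w = a].
Proof.
move=> rP a; apply/seteqP; split => w /=.
  move=> [M [_ HM]]; exists (Num.bound `|M|) => // k _ /= Mk; apply: HM.
  by rewrite (le_lt_trans (ler_norm M)) // (lt_le_trans (archi_boundP _)).
move=> [n _ Hn]; exists n%:R; split => // t nt.
have [e e0 He] := @near_right t w (le_trans (ler0n _ _) (ltW nt)).
have [|k /andP[tk ke]] := rP t (t + e); first by rewrite ltrDl.
rewrite -(He (r k)) ?tk //; apply: (Hn k) => //=; exact: ltW (lt_trans nt tk).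
Qed.

Lemma measurable_after (c : bool) (X : {RV P >-> config L}) a :
  measurable [set w | c -> X w = a].
Proof.
case: c; last by rewrite (_ : [set w | _] = setT) //; apply/seteqP; split.
rewrite (_ : [set w | _] = X @^-1` [set a]); first exact: measurable_config.
by apply/seteqP; split => w //=; apply.
Qed.

Lemma measurable_conv_to a : measurable (conv_to a).
Proof.
have [r rP] := dense_seq; rewrite (conv_toE rP).
apply: bigcupT_measurable => n; apply: bigcapT_measurable => k.
exact: measurable_after.
Qed.

Lemma eta_infty_conv a w : conv_to a w -> eta_infty eta w = a /\
  cvg (eta t w @[t --> +oo]).
Proof.
move=> wa; have wa' : eta t w @[t --> +oo] --> a by exact: cvg_near_cst.
have wl := cvgP _ wa'; split => //; rewrite /eta_infty.
have : \forall t \near +oo, eta t w = lim (eta t w @[t --> +oo])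
  by exact: (wl [set _] (discrete_set1 _)).
move=> wl'; have : \forall t \near (+oo : set_system R), lim (eta t w @[t --> +oo]) = a.
  by near=> t; rewrite -(near wl' t) // (near wa t).
by move=> /pinfty_ex_gt0[].
Unshelve. all: by end_near. Qed.

(** In a discrete space a convergent path is eventually constant; all other paths receive the
    default value of [lim], which makes [eta_infty] measurable everywhere. *)
Lemma eta_infty_dvg w : (forall a, ~ conv_to a w) -> eta_infty eta w = point.
Proof.
move=> nw; rewrite /eta_infty dvgP // => wl; apply: (nw (lim (eta t w @[t --> +oo]))).
exact: (wl [set _] (discrete_set1 _)).
Qed.

Lemma measurable_eta_infty1 a : measurable (eta_infty eta @^-1` [set a]).
Proof.
pose dvg := ~` \bigcup_(b in [set: config L]) conv_to b.
have mdvg : measurable dvg.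
  apply/measurableC/fin_bigcup_measurable => [|b _]; first exact: finite_finset.
  exact: measurable_conv_to.
suff -> : eta_infty eta @^-1` [set a] =
    conv_to a `|` (if a == point then dvg else set0).
  by apply: measurableU; [exact: measurable_conv_to|case: ifP].
apply/seteqP; split => w /=.
  move=> wa; have [|nw] := pselect (exists b, conv_to b w).
    by move=> [b wb]; left; rewrite -wa (eta_infty_conv wb).1.
  right; rewrite -wa eta_infty_dvg ?eqxx; last by move=> b wb; apply: nw; exists b.
  by move=> [b _ wb]; apply: nw; exists b.
case=> [/eta_infty_conv[]//|]; case: eqP => // -> nw; apply: eta_infty_dvg => b wb.
by apply: nw; exists b.
Qed.

Lemma measurable_eta_infty : measurable_fun [set: Omega] (eta_infty eta).
Proof.
move=> _ A _; rewrite setTI.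
have -> : eta_infty eta @^-1` A = \bigcup_(a in A) (eta_infty eta @^-1` [set a]).
  apply/seteqP; split => w /=; first by move=> wA; exists (eta_infty eta w).
  by move=> [a aA /= ->].
apply: fin_bigcup_measurable => [|a _]; first exact: finite_finset.
exact: measurable_eta_infty1.
Qed.

(** A path at [a] at time [n] but elsewhere at a later time [r k] lies in the null set [bad k],
    since [a] is absorbing; outside these countably many sets the path converges to [a]. *)
Lemma conv_to_ge_law a (n : nat) : frozen a ->
  ((law N p n%:R a)%:E <= P (conv_to a))%E.
Proof.
move=> fa; have [r rP] := dense_seq.
pose E t := eta t @^-1` [set a].
have mE t : measurable (E t) by exact: measurable_config.
pose bad k := if n%:R <= r k then E n%:R `\` E (r k) else set0.
have bad0 k : P.-negligible (bad k).
  rewrite /bad; case: ifPn => nk; last exact: negligible_set0.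
  apply/negligibleP; first exact: measurableD.
  transitivity (P (E n%:R) - P (E n%:R `&` E (r k)))%E.
    by apply: measureD => //; rewrite ltey_eq fin_num_measure.
  rewrite (frozen_stays_prob heta) ?ler0n //.
  by rewrite (lawE heta) // subee.
have mbad : measurable (\bigcup_k bad k).
  by apply: bigcupT_measurable => k; rewrite /bad; case: ifP => // _; exact: measurableD.
rewrite -(lawE heta) //; apply: (@le_trans _ _ (P (conv_to a `|` \bigcup_k bad k))).
  apply: le_measure; rewrite ?inE; first exact: mE.
    by apply: measurableU => //; exact: measurable_conv_to.
  move=> w wa; have [[k wk]|nbad] := pselect (exists k, bad k w).
    by right; exists k.
  left; rewrite (conv_toE rP); exists n => // k _ /= nk.
  by apply: contrapT => wk; apply: nbad; exists k; rewrite /bad nk.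
apply: (le_trans (measureU2 _ _ _)) => //; first exact: measurable_conv_to.
by rewrite (measure_negligible mbad (negligible_bigcup bad0)) adde0.
Qed.

Lemma absorption_le_conv a : (((absorption N p a)%:E : \bar R) <= P (conv_to a))%E.
Proof.
have mC := measurable_conv_to a.
rewrite /absorption; case: ifP => [/andP[fa /eqP aN]|_]; last exact: measure_ge0.
have [K KP] := law_limit hN hp heta fa aN.
rewrite -(fineK (fin_num_measure P _ mC)) lee_fin.
apply/ler_addgt0Pr => e e0; pose n := (Num.bound (`|K| / e)).+1.
have n0 : 0 < n%:R :> R by rewrite ltr0n.
apply: le_trans (KP _ n0) _; apply: lerD.
  by rewrite -lee_fin (fineK (fin_num_measure P _ mC)); exact: conv_to_ge_law.
have Kn : `|K| / e < n%:R.
  apply: lt_le_trans (archi_boundP _) _; last by rewrite ler_nat.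
  by rewrite divr_ge0 // ltW.
rewrite ler_pdivrMr // mulrC -ler_pdivrMr //; apply: le_trans (ltW Kn).
by rewrite ler_pM2r ?invr_gt0 // ler_norm.
Qed.

Let ev a := eta_infty eta @^-1` [set a].
Let mev a : measurable (ev a). Proof. exact: measurable_eta_infty1. Qed.

Let conv_ev a : conv_to a `<=` ev a.
Proof. by move=> w /eta_infty_conv[]. Qed.

(** Each probability is at least the corresponding value of [absorption], and both families add up
    to 1, so all these inequalities are equalities. *)
Lemma prob_eta_infty a : P (ev a) = (absorption N p a)%:E.
Proof.
pose c a := fine (P (ev a)).
have cE b : P (ev b) = (c b)%:E by rewrite fineK // fin_num_measure.
have c1 : \sum_b c b = 1.
  apply: EFin_inj; rewrite -sumEFin -(@probability_setT _ _ _ P).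
  rewrite (measure_partition P measurableT mev); apply: eq_bigr => b _.
  by rewrite setTI -cE.
have cm b : 0 <= c b - absorption N p b.
  rewrite subr_ge0 -lee_fin -cE (le_trans (absorption_le_conv b)) //.
  by apply: le_measure; rewrite ?inE //; exact: measurable_conv_to.
have : \sum_b (c b - absorption N p b) == 0.
  by rewrite sumrB c1 sum_absorption // subrr.
rewrite psumr_eq0 // => /allP/(_ a); rewrite mem_index_enum => /(_ isT) /=.
by rewrite subr_eq0 cE => /eqP ->.
Qed.

(** The event [ev a] has probability [absorption N p a], and already its subset [conv_to a] has at
    least that, so the difference is null for each of the finitely many [a]. *)
Lemma eta_infty_cvg : {ae P, forall w, cvg (eta t w @[t --> +oo])}.
Proof.
pose bad := ~` \bigcup_(b in [set: config L]) conv_to b.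
have mbad : measurable bad.
  apply/measurableC/fin_bigcup_measurable => [|b _]; first exact: finite_finset.
  exact: measurable_conv_to.
have mD a : measurable (ev a `\` conv_to a).
  by apply: measurableD => //; exact: measurable_conv_to.
exists bad; split => //; last first.
  move=> w /= nw [b _ wb]; apply: nw; exact: (eta_infty_conv wb).2.
rewrite (measure_partition P mbad mev) big1 // => a _; apply/eqP.
rewrite -measure_le0 (@le_trans _ _ (P (ev a `\` conv_to a))) //.
  apply: le_measure; rewrite ?inE; [|exact: mD|].
    by apply: measurableI => //; exact: mev.
  by move=> w [nw wa]; split => // wc; apply: nw; exists a.
have mC := measurable_conv_to a.
have -> : P (ev a `\` conv_to a) = (P (ev a) - P (ev a `&` conv_to a))%E.
  by apply: measureD => //; rewrite ltey_eq fin_num_measure.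
rewrite setIidr // prob_eta_infty leeBlDr ?fin_num_measure // add0e.
exact: absorption_le_conv.
Qed.

Lemma pushforward_eta_infty (A : set (config L)) :
  pushforward P (eta_infty eta) A = (\sum_x absorption N p x * (x \in A)%:R)%:E.
Proof.
rewrite /pushforward (measure_partition P (B := eta_infty eta @^-1` A) _ mev); last first.
  by rewrite -[X in measurable X]setTI; exact: measurable_eta_infty.
rewrite -sumEFin; apply: eq_bigr => a _.
have [aA|aA] := boolP (a \in A).
  rewrite mulr1 -prob_eta_infty; congr (P _); apply/seteqP; split => w /=; first by case.
  by move=> wa; split => //; rewrite wa; exact: set_mem.
rewrite mulr0 (_ : _ `&` _ = set0) ?measure0 //; apply/seteqP; split => w //=.
by move=> [wA wa]; move: aA; rewrite notin_setE -wa.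
Qed.

End limit.

Lemma sum_pushforward_nu (R : realType) L N (A : set (config L)) :
  (\sum_(0 <= i < L) pushforward (@nu R L N) (iter i (@tau L)) A)%E =
  (\sum_(i < L) \sum_(q : (L - 2 * N).-tuple 'I_L | admissible q)
     nu_weight R q * (iter i (@tau L) (config_of q) \in A)%:R)%:E.
Proof.
rewrite big_mkord -sumEFin; apply: eq_bigr => i _.
rewrite /pushforward /nu -sumEFin; apply: eq_bigr => q _.
by rewrite diracE EFinM; congr (_ * _%:R%:E)%E; congr nat_of_bool.
Qed.

Theorem theorem3p5 (R : realType) (L N : nat) (hL : (1 <= L)%N)
    (hN : (2 * N < L)%N) (p : R) (hp : 0 <= p <= 1)
    (d : measure_display) (Omega : measurableType d) (P : probability Omega R)
    (eta : R -> {RV P >-> config L}) (heta : is_fasep p N eta) :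
  [/\ {ae P, forall w, cvg (eta t w @[t --> +oo])},
      measurable_fun [set: Omega] (eta_infty eta)
    & forall A : set (config L),
        pushforward P (eta_infty eta) A =
        ((L%:R^-1)%:E *
          \sum_(0 <= i < L) pushforward (@nu R L N) (iter i (@tau L)) A)%E].
Proof.
split; first exact: eta_infty_cvg heta; first exact: measurable_eta_infty heta.
move=> A; rewrite (pushforward_eta_infty hN hp heta) sum_pushforward_nu.
by rewrite -EFinM (sum_rotations hN hp (fun x => (x \in A)%:R)) mulKf // pnatr_eq0 -lt0n.
Qed.
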